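(* Let $\mathcal{H}\neq\{0\}$ be a real Hilbert space, let $T>0$, let $r>0$ and let $\mathcal{Z}\subseteq\mathcal{H}$ be an $r$-prox-regular set. The play operator $$\mathsf{P}: \big(C([0,T];\mathcal{H})\cap BV([0,T];\mathcal{H})\big)\times\mathcal{Z}\to C([0,T];\mathcal{H})\cap BV([0,T];\mathcal{H})$$ is continuous with respect to the $BV$-norm; i.e., if $u,u_n\in C([0,T];\mathcal{H})\cap BV([0,T];\mathcal{H})$ and $z_0,z_{0,n}\in\mathcal{Z}$ for every $n\in\mathbb{N}$, and $$\|u-u_n\|_{BV}\to 0,\qquad \|z_0-z_{0,n}\|\to 0\qquad\text{as } n\to\infty,$$ then $$\|\mathsf{P}(u,z_0)-\mathsf{P}(u_n,z_{0,n})\|_{BV}\to 0\qquad\text{as } n\to\infty.$$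
   Context: Inner product and norm of $\mathcal{H}$ are $\langle\cdot,\cdot\rangle$ and $\|\cdot\|$. Prox-regularity: for closed nonempty $\mathcal{K}\subseteq\mathcal{H}$ and $y\in\mathcal{H}$ put $d_{\mathcal{K}}(y)=\inf_{s\in\mathcal{K}}\|y-s\|$ and $\mathrm{Proj}_{\mathcal{K}}(y)=\{x\in\mathcal{K}: \|x-y\|=d_{\mathcal{K}}(y)\}$. For $r\in(0,\infty)$, a closed set $\mathcal{K}$ is $r$-prox-regular if for every $y\in\mathcal{H}$ with $0<d_{\mathcal{K}}(y)<r$ one has $\mathrm{Proj}_{\mathcal{K}}(y)\neq\varnothing$ and $x\in\mathrm{Proj}_{\mathcal{K}}\big(x+r\frac{y-x}{\|y-x\|}\big)$ for all $x\in\mathrm{Proj}_{\mathcal{K}}(y)$. Functions of bounded variation: $V(f,J)=\sup\sum_{j=1}^m\|f(t_j)-f(t_{j-1})\|$, the supremum being over all $m\ge1$ and $t_0<\dots<t_m$ in $J$. $BV([0,T];\mathcal{H})$ is the set of $f:[0,T]\to\mathcal{H}$ with $V(f,[0,T])<\infty$, and $\|f\|_{BV}=\|f\|_\infty+V(f,[0,T])$ with $\|f\|_\infty=\sup_{t\in[0,T]}\|f(t)\|$. For continuous $f\in BV([0,T];\mathcal{H})$, $Df$ is its differential (Lebesgue–Stieltjes) measure: the unique $\mathcal{H}$-valued Borel measure of bounded variation on $[0,T]$ with $Df([c,d])=f(d)-f(c)$ for $0\le c\le d\le T$; $|Df|$ denotes its total variation measure. For bounded Borel $g:[0,T]\to\mathcal{H}$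 that are $|Df|$-integrable, $\int_{[0,T]}\langle g,dDf\rangle$ is the continuous linear extension (in the $L^1(|Df|;\mathcal{H})$ seminorm) of $\sum_j\langle g_j,Df(A_j)\rangle$ for step maps $\sum_j \mathbf{1}_{A_j}g_j$. Play operator: for $u\in C([0,T];\mathcal{H})\cap BV([0,T];\mathcal{H})$ and $z_0\in\mathcal{Z}$, $\mathsf{P}(u,z_0)$ is the unique (it is known that it exists and is unique) $y\in C([0,T];\mathcal{H})\cap BV([0,T];\mathcal{H})$ such that $u(t)-y(t)\in\mathcal{Z}$ for all $t\in[0,T]$, $u(0)-y(0)=z_0$, and $$\int_{[0,T]}\langle z(t)-u(t)+y(t),dDy(t)\rangle\le\frac1{2r}\int_{[0,T]}\|z(t)-u(t)+y(t)\|^2\,d|Dy|(t)$$ for all $z\in BV([0,T];\mathcal{H})$ with $z([0,T])\subseteq\mathcal{Z}$. *)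

(* Defs.v *)
From mathcomp Require Import all_boot all_order all_algebra.
From mathcomp Require Import all_classical all_reals all_analysis.

Set Implicit Arguments.
Unset Strict Implicit.
Unset Printing Implicit Defensive.

Import Order.TTheory GRing.Theory Num.Theory.
Import numFieldNormedType.Exports.

Local Open Scope classical_set_scope.
Local Open Scope ring_scope.

Section prox_regularity.
Context {R : realType} {H : normedModType R}.
Implicit Types (K : set H) (x y : H) (r : R).

Definition dist_set K y : R := inf [set `|y - s| | s in K].

Definition Proj K y : set H := [set x | K x /\ `|x - y| = dist_set K y].

Definition prox_regular r K : Prop :=
  [/\ closed K, K !=set0 &
   forall y, 0 < dist_set K y < r ->
     Proj K y !=set0 /\
     forall x, Proj K y x -> Proj K (x + (r / `|y - x|) *: (y - x)) x].

End prox_regularity.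

(* A function on [0, T] is a total function R -> H of which only the values on
   [0, T] matter. *)
Section bounded_variation_functions.
Context {R : realType} {H : normedModType R}.
Implicit Types (f : R -> H) (J : set R) (T : R).

(* The library's [total_variation] is restricted to real-valued functions. *)
Definition variation_on f J : \bar R :=
  ereal_sup [set v | exists (m : nat) (t : nat -> R),
    [/\ (0 < m)%N,
        forall j, (j <= m)%N -> J (t j),
        forall j, (j < m)%N -> t j < t j.+1 &
        v = (\sum_(j < m) `|f (t j.+1) - f (t j)|)%:E]].

Definition BV T f : Prop := (variation_on f `[0%R, T] < +oo)%E.

Definition sup_norm T f : \bar R := ereal_sup [set `|f t|%:E | t in `[0, T]].

Definition BV_norm T f : \bar R := (sup_norm T f + variation_on f `[0%R, T])%E.

Definition CBV T f : Prop := {within `[0, T], continuous f} /\ BV T f.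

End bounded_variation_functions.

(* An H-valued Borel measure on a Borel set D of reals is a set function of
   which only the values on the Borel subsets of D matter. *)
Section vector_measures.
Context {R : realType} {H : normedModType R}.
Implicit Types (mu : set R -> H) (D A : set R).

Definition vector_measure D mu : Prop :=
  forall F : nat -> set R,
    (forall i, measurable (F i)) -> (forall i, F i `<=` D) ->
    trivIset setT F ->
    (fun n => \sum_(0 <= i < n) mu (F i)) @ \oo --> mu (\bigcup_i F i).

(* |mu|(A `&` D), computed with finite disjoint families of Borel subsets of
   A `&` D. *)
Definition vm_variation D mu A : \bar R :=
  ereal_sup [set v | exists (m : nat) (F : 'I_m -> set R),
    [/\ forall i, measurable (F i),
        forall i, F i `<=` A `&` D,
        trivIset setT F &
        v = (\sum_(i < m) `|mu (F i)|)%:E]].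

(* mu is the differential measure Df; it is determined by f on the Borel
   subsets of [0, T]. *)
Definition differential_measure (T : R) (f : R -> H) mu : Prop :=
  [/\ vector_measure `[0, T] mu,
      (vm_variation `[0%R, T] mu `[0%R, T] < +oo)%E &
      forall c d : R, 0 <= c -> c <= d -> d <= T -> mu `[c, d]%classic = f d - f c].

Record step_map D := StepMap {
  step_size : nat;
  step_set : 'I_step_size -> set R;
  step_val : 'I_step_size -> H;
  step_set_measurable : forall j, measurable (step_set j);
  step_set_sub : forall j, step_set j `<=` D }.

Definition step_fun D (s : step_map D) (t : R) : H :=
  \sum_(j < step_size s) \1_(step_set j) t *: step_val j.

Variable dot : H -> H -> R.

Definition step_integral D mu (s : step_map D) : R :=
  \sum_(j < step_size s) dot (step_val j) (mu (step_set j)).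

(* The integral of <g, dmu> over D, for g in the L^1(|mu|; H)-closure of the
   step maps: limit of the integrals of step maps converging to g in the
   L^1(|mu|; H) seminorm (0 by default outside of this closure). *)
Definition dot_integral D mu (g : R -> H) : R :=
  xget 0 [set I | exists s : nat -> step_map D,
    (\int[vm_variation D mu]_(t in D) `|g t - step_fun (s n) t|%:E)%E
      @[n --> \oo] --> 0%E /\
    step_integral mu (s n) @[n --> \oo] --> I].

End vector_measures.

(* The graph of the play operator: [is_play dot T r Z u z0 y] means
   y = P(u, z0). *)
Definition is_play {R : realType} {H : normedModType R} (dot : H -> H -> R)
    (T r : R) (Z : set H) (u : R -> H) (z0 : H) (y : R -> H) : Prop :=
  [/\ CBV T y,
      forall t : R, t \in `[0, T] -> Z (u t - y t),
      u 0 - y 0 = z0 &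
      exists2 Dy, differential_measure T y Dy &
        forall z : R -> H, BV T z -> (forall t : R, t \in `[0, T] -> Z (z t)) ->
        let w := fun t => z t - u t + y t in
        ((dot_integral dot `[0%R, T] Dy w)%:E <=
         ((2 * r)^-1)%:E *
         \int[vm_variation `[0%R, T] Dy]_(t in `[0%R, T])
           (`|w t| ^+ 2)%:E)%E].

(* Main.v *)
From HB Require Import structures.
Require Import Defs.
From mathcomp Require Import all_boot all_order all_algebra.
From mathcomp Require Import all_classical all_reals all_analysis.
From mathcomp Require Import measurable_realfun ring lra.
Import Order.TTheory GRing.Theory Num.Theory.
Import numFieldNormedType.Exports.
Local Open Scope classical_set_scope.
Local Open Scope ring_scope.

Set Implicit Arguments.
Unset Strict Implicit.
Unset Printing Implicit Defensive.

(**
Let [x = u - y] be the part of the input [u] that stays in [Z], and let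
[w = u - 2 y = x - y] be the reflected input. The measure [Dy] is normal to [Z]
at [x], up to an error that is quadratic in the displacement, whereas [x] itself
moves inside [Z], both forwards and backwards in time. To first order this
leaves no room for a component of [Dx] along [Dy], so that
[|Dw| = |Dx - Dy| = |Dx + Dy| = |Du|]: reflection preserves the variation. This
is what makes convergence in variation possible. If the data converge, then
[y_n], and with it [w_n], converges uniformly by a Gronwall argument, and
[|Dw_n| = |Du_n|] converges to [|Du| = |Dw|] in total variation. In a Hilbert
space, uniform convergence together with this convergence of the variations
forces [D(w_n - w)] to tend to zero in total variation, and
[y = (u - w) / 2] inherits the conclusion.

All this is carried out with finite sums. The variation [var f t] of [f] on
[[0, t]] is handled as the least function whose increments dominate those of
[f] ([var_dominates], [var_least]); by minimality it is continuous when [f] is.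

The integrals of the variational inequality are removed at the start. The total
variation of [Dy] is the Stieltjes measure of [var y] ([vm_variationE]), and a
test function that equals a point [p] of [Z] on a short interval and [x]
elsewhere turns the variational inequality into an estimate of
[dot (p - x c) (y b - y a)] for [a <= c <= b] ([play_local]).

Orthogonality of [Dx] and [Dy] then becomes [small_scale_orthogonality]. With
the gauge [var u t + var y t + t] as parameter, [x] and [y] are Lipschitz. The
energy [sum_i N |D_i x|^2] of the increments over a uniform partition increases
under refinement and is bounded, so that on a fine enough partition [x] and [y]
are affine up to a small error. On each interval the Riemann sums of
[dot (x(end) - x) dy] and of [dot (x - x(start)) dy] are then both about
[dot (D x) (D y) / 2], while [play_local] bounds the first from above and the
second from below. The consequences for the variations are
[reflected_dominated] and [var_reflected_ge].

The other two ingredients are [play_stability], where the inequalities of two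
solutions, each tested with the other one, are added and summed by a discrete
Gronwall lemma, and [strong_convergence_estimate], the passage from uniform
convergence to convergence in variation.
*)

(** * Inner products *)

Section inner_product.
Context {R : realType} {H : normedModType R} (dot : {dot H for idfun}).

Lemma dotC a b : dot a b = dot b a.
Proof. by rewrite hermC expr0 mul1r. Qed.

Lemma dotDl a b c : dot (a + b) c = dot a c + dot b c.
Proof. by rewrite linearDl. Qed.

Lemma dotDr a b c : dot a (b + c) = dot a b + dot a c.
Proof. by rewrite dotC dotDl !(dotC a). Qed.

Lemma dotZl k a b : dot (k *: a) b = k * dot a b.
Proof. by rewrite linearZl_LR. Qed.

Lemma dotZr k a b : dot a (k *: b) = k * dot a b.
Proof. by rewrite dotC dotZl dotC. Qed.

Lemma dotNl a b : dot (- a) b = - dot a b.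
Proof. by rewrite -scaleN1r dotZl mulN1r. Qed.

Lemma dotNr a b : dot a (- b) = - dot a b.
Proof. by rewrite dotC dotNl dotC. Qed.

Lemma dotBl a b c : dot (a - b) c = dot a c - dot b c.
Proof. by rewrite dotDl dotNl. Qed.

Lemma dotBr a b c : dot a (b - c) = dot a b - dot a c.
Proof. by rewrite dotDr dotNr. Qed.

Lemma dot0l b : dot 0 b = 0.
Proof. by rewrite -(scale0r (0 : H)) dotZl mul0r. Qed.

Lemma dot0r b : dot b 0 = 0.
Proof. by rewrite dotC dot0l. Qed.

Lemma dot_suml (I : Type) (s : seq I) (P : pred I) (F : I -> H) b :
  dot (\sum_(i <- s | P i) F i) b = \sum_(i <- s | P i) dot (F i) b.
Proof.
by apply: (big_morph (dot ^~ b)) => [x y|]; rewrite ?dotDl ?dot0l.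
Qed.

Lemma dot_sumr (I : Type) (s : seq I) (P : pred I) (F : I -> H) b :
  dot b (\sum_(i <- s | P i) F i) = \sum_(i <- s | P i) dot b (F i).
Proof. by rewrite dotC dot_suml; apply: eq_bigr => i _; exact: dotC. Qed.

Hypothesis dot_norm : forall x : H, dot x x = `|x| ^+ 2.

Lemma normD_sqr a b : `|a + b| ^+ 2 = `|a| ^+ 2 + 2 * dot a b + `|b| ^+ 2.
Proof. by rewrite -!dot_norm dotDl !dotDr (dotC b a); ring. Qed.

Lemma normB_sqr a b : `|a - b| ^+ 2 = `|a| ^+ 2 - 2 * dot a b + `|b| ^+ 2.
Proof. by rewrite normD_sqr dotNr normrN; ring. Qed.

Lemma dot_le_norm a b : dot a b <= `|a| * `|b|.
Proof.
have := sqr_ge0 `|(`|b| *: a - `|a| *: b)|.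
rewrite normB_sqr dotZl dotZr !normrZ !normr_id.
have [->|a0] := eqVneq a 0; first by rewrite dot0l normr0 mul0r.
have [->|b0] := eqVneq b 0; first by rewrite dot0r normr0 mulr0.
have : 0 < `|a| * `|b| by rewrite mulr_gt0 ?normr_gt0.
move: `|a| `|b| (dot a b) => p q d pq.
have -> : (q * p) ^+ 2 - 2 * (q * (p * d)) + (p * q) ^+ 2 =
  2 * (p * q) * (p * q - d) by ring.
by rewrite pmulr_rge0 ?subr_ge0// mulr_gt0.
Qed.

Lemma normr_dot_le a b : `|dot a b| <= `|a| * `|b|.
Proof.
by rewrite ler_norml dot_le_norm andbT lerNl -dotNl -(normrN a) dot_le_norm.
Qed.

(** Nearly orthogonal vectors have a sum and a difference of nearly the same
    length; the weight [h] is free, so that the error can be summed. *)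
Lemma normB_le_normD a b (h : R) : 0 < h ->
  `|a - b| <= `|a + b| + h + `|dot a b| / h.
Proof.
move=> h0; have d0 : 0 <= `|dot a b| / h by rewrite divr_ge0 // ltW.
rewrite -ler_sqr ?nnegrE ?addr_ge0 ?(ltW h0)//.
have : `|a - b| ^+ 2 = `|a + b| ^+ 2 - 4 * dot a b.
  by rewrite normB_sqr normD_sqr; ring.
move=> ->; set q := `|dot a b| / h in d0 *.
have hq : `|dot a b| = h * q by rewrite /q mulrCA divff ?mulr1 ?gt_eqF.
have : - dot a b <= h * q by rewrite -hq ler_normr lexx orbT.
have := normr_ge0 (a + b); move: `|a + b| (dot a b) => p d p0 dq.
have : 0 <= p * (h + q) by rewrite mulr_ge0// addr_ge0// ltW.
have : 0 <= (h - q) ^+ 2 by exact: sqr_ge0.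
nra.
Qed.

(** A vector [a] of length at most [v] whose component along the unit vector
    [phi] is nearly [v] is nearly [v *: phi]. By the inequality between
    arithmetic and geometric means the bound is linear in [v] and [a], so that
    it is additive over consecutive increments. *)
Lemma norm_sub_direction_le a phi (v eta : R) : 0 < eta ->
  `|a| <= v -> `|phi| <= 1 ->
  `|a - v *: phi| <= eta * v + (v - dot phi a) / (2 * eta).
Proof.
move=> e0 av p1; have v0 : 0 <= v := le_trans (normr_ge0 _) av.
have q0 : 0 <= v - dot phi a.
  rewrite subr_ge0; apply: le_trans (dot_le_norm _ _) _.
  by apply: le_trans (ler_wpM2r _ p1) _; rewrite ?mul1r.
have r0 : 0 <= (v - dot phi a) / (2 * eta).
  by rewrite divr_ge0// mulr_ge0// ltW.
rewrite -ler_sqr ?nnegrE ?addr_ge0 ?(mulr_ge0 (ltW e0) v0)//.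
rewrite normB_sqr dotZr normrZ (ger0_norm v0) (dotC a).
set q := (v - dot phi a) / (2 * eta) in r0 *.
have qE : v - dot phi a = 2 * eta * q.
  by rewrite /q mulrCA divff ?mulr1// mulf_neq0 ?gt_eqF.
have a2 : `|a| ^+ 2 <= v ^+ 2 by rewrite ler_sqr ?nnegrE.
have vp : (v * `|phi|) ^+ 2 <= v ^+ 2.
  by rewrite ler_sqr ?nnegrE ?mulr_ge0// ler_piMr.
have := sqr_ge0 (eta * v - q).
have -> : dot phi a = v - 2 * eta * q by rewrite -qE; ring.
nra.
Qed.

End inner_product.

(** * The variation as a least dominating function *)

Section clamp.
Context {R : realType}.
Implicit Types (s t T : R).

Definition clamp T t : R := Num.max 0 (Num.min t T).

Lemma clamp_ge0 T t : 0 <= clamp T t.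
Proof. by rewrite /clamp le_max lexx. Qed.

Lemma clamp_le T t : 0 <= T -> clamp T t <= T.
Proof. by move=> T0; rewrite /clamp ge_max T0 ge_min lexx orbT. Qed.

Lemma clamp_homo T s t : s <= t -> clamp T s <= clamp T t.
Proof. move=> st; rewrite /clamp ge_max !le_max lexx/=.
by rewrite le_min !ge_min lexx st !orbT. Qed.

Lemma clamp_id T t : 0 <= t -> t <= T -> clamp T t = t.
Proof. by move=> t0 tT; rewrite /clamp min_l// max_r. Qed.

Lemma clamp0 T t : 0 <= T -> t <= 0 -> clamp T t = 0.
Proof. by move=> T0 t0; rewrite /clamp min_l ?max_l// (le_trans t0). Qed.

Lemma clampT T t : 0 <= T -> T <= t -> clamp T t = T.
Proof. by move=> T0 Tt; rewrite /clamp min_r// max_r. Qed.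

Lemma clampP T t : 0 <= T -> [\/ t <= 0 /\ clamp T t = 0,
  (0 <= t /\ t <= T) /\ clamp T t = t | T <= t /\ clamp T t = T].
Proof.
move=> T0; have [t0|t0] := leP t 0; first by apply: Or31; rewrite clamp0.
have [tT|Tt] := leP t T; first by apply: Or32; rewrite clamp_id// ltW.
by apply: Or33; rewrite clampT// ltW.
Qed.

End clamp.

Section variation.
Context {R : realType} {H : normedModType R}.
Implicit Types (f g : R -> H) (F G : R -> R) (a b c d T : R).

Definition dominates a b f G :=
  forall s t, a <= s -> s <= t -> t <= b -> `|f t - f s| <= G t - G s.

Definition chain a b (s : nat -> R) :=
  forall j, [/\ a <= s j, s j <= b & s j <= s j.+1].

Definition chain_sum f (s : nat -> R) m : R :=
  \sum_(j < m) `|f (s j.+1) - f (s j)|.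

(** Points may repeat, so that the partitions of a degenerate interval need no
    special treatment: [var f 0 = 0]. *)
Definition var f t : R :=
  sup [set S | exists p m, chain 0 t p /\ S = chain_sum f p m].

Lemma dominates_homo a b f G : dominates a b f G ->
  forall s t, a <= s -> s <= t -> t <= b -> G s <= G t.
Proof.
by move=> fG s t ? ? ?; rewrite -subr_ge0; apply: le_trans (fG s t _ _ _).
Qed.

Lemma dominates_sum_le a b f G (s : nat -> R) m : dominates a b f G ->
  (forall j, (j <= m)%N -> a <= s j <= b) ->
  (forall j, (j < m)%N -> s j <= s j.+1) ->
  \sum_(j < m) `|f (s j.+1) - f (s j)| <= G (s m) - G (s 0%N).
Proof.
move=> fG; elim: m => [|m IH] sab smono; first by rewrite big_ord0 subrr.
rewrite big_ord_recr/=.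
have -> : G (s m.+1) - G (s 0%N) =
   (G (s m) - G (s 0%N)) + (G (s m.+1) - G (s m)) by ring.
apply: lerD.
  by apply: IH => j jm; [apply: sab; apply: leqW | apply: smono; apply: ltnW].
have /andP[? ?] := sab m (leqnSn m); have /andP[? ?] := sab m.+1 (leqnn _).
by apply: fG => //; apply: smono.
Qed.

Lemma chain_le a b (s : nat -> R) : chain a b s -> forall i j, (i <= j)%N -> s i <= s j.
Proof.
move=> sc i j; elim: j => [|j IH]; first by rewrite leqn0 => /eqP->.
rewrite leq_eqVlt => /orP[/eqP->//|/IH] /le_trans; apply.
by have [] := sc j.
Qed.

Lemma chain_sum_le a b f G (s : nat -> R) m : dominates a b f G ->
  chain a b s -> chain_sum f s m <= G b - G a.
Proof.
move=> fG sc; apply: le_trans (dominates_sum_le fG _ _) _.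
- by move=> j _; have [-> ->] := sc j.
- by move=> j _; have [] := sc j.
have [a0 b0 _] := sc 0%N; have [am bm _] := sc m.
by apply: lerB; apply: (dominates_homo fG) => //;
  apply: le_trans (chain_le sc (leq0n m)).
Qed.

Lemma variation_on_le T f G : 0 <= T -> dominates 0 T f G ->
  (variation_on f `[0%R, T] <= (G T - G 0)%:E)%E.
Proof.
move=> T0 fG; apply: ub_ereal_sup => _ [m [t [m0 tJ tmono ->]]].
rewrite lee_fin; have tJ' j : (j <= m)%N -> 0 <= t j <= T.
  by move=> /tJ /=; rewrite in_itv.
apply: le_trans (dominates_sum_le fG tJ' _) _; first by move=> j /tmono/ltW.
have /andP[? ?] := tJ' 0%N (leq0n _); have /andP[? ?] := tJ' m (leqnn _).
by apply: lerB; apply: (dominates_homo fG).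
Qed.

(** Dropping the repeated points of a chain leaves the sum unchanged. *)
Lemma chain_sum_strict a b f (s : nat -> R) m : chain a b s ->
  exists m' t, [/\ forall j, (j <= m')%N -> `[a, b]%classic (t j),
    forall j, (j < m')%N -> t j < t j.+1, t m' = s m &
    chain_sum f s m = \sum_(j < m') `|f (t j.+1) - f (t j)|].
Proof.
move=> sc; elim: m => [|m [m' [t [tJ tmono tm tsum]]]].
  exists 0%N, (fun=> s 0%N); split => //.
    by move=> j _ /=; rewrite in_itv/=; have [-> ->] := sc 0%N.
  by rewrite /chain_sum !big_ord0.
have [am bm] := sc m.+1; have [_ _] := sc m; rewrite le_eqVlt => /orP[/eqP sE|slt].
  exists m', t; split => //; first by rewrite tm.
  by rewrite /chain_sum big_ord_recr/= -sE subrr normr0 addr0.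
exists m'.+1, (fun j => if (j <= m')%N then t j else s m.+1); split.
- move=> j _; case: leqP => [/tJ//|_] /=.
  by rewrite in_itv/= am.
- move=> j; rewrite ltnS => jm'; rewrite jm'.
  case: ltnP => [/tmono//|m'j].
  have -> : j = m' by apply/eqP; rewrite eqn_leq jm' m'j.
  by rewrite tm.
- by rewrite ltnn.
rewrite /chain_sum !big_ord_recr/= leqnn ltnn tm; congr (_ + _).
rewrite -/(chain_sum f s m) tsum; apply: eq_bigr => j _.
by rewrite (ltn_ord j) ltnW.
Qed.

(** Unless the chain is constant, its distinct points form a partition. The case
    of a constant chain uses that [[0, T]] has two points. *)
Lemma chain_sum_le_variation T f (s : nat -> R) m : 0 < T -> chain 0 T s ->
  ((chain_sum f s m)%:E <= variation_on f `[0%R, T])%E.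
Proof.
move=> T0 sc; have [m' [t [tJ tmono _ ->]]] := chain_sum_strict f m sc.
case: m' => [|m'] in tJ tmono *; last first.
  by apply: ereal_sup_ubound => /=; exists m'.+1, t.
rewrite big_ord0; apply: (@le_trans _ _ (`|f T - f 0|)%:E).
  by rewrite lee_fin.
apply: ereal_sup_ubound; exists 1%N, (fun j => if j is 0%N then 0 else T).
split => //; last by rewrite big_ord1.
- by case=> [|j] _; rewrite /= in_itv/= lexx ltW.
- by case.
Qed.

Lemma BV_dominated T f G : 0 <= T -> dominates 0 T f G -> BV T f.
Proof.
by move=> T0 fG; apply: le_lt_trans (variation_on_le T0 fG) _; rewrite ltry.
Qed.

Lemma chain_widen a b c (s : nat -> R) : b <= c -> chain a b s -> chain a c s.
Proof. by move=> bc sc j; have [? ? ?] := sc j; split => //; exact: le_trans bc. Qed.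

Section bounded.
Context (T : R) (f : R -> H).
Hypotheses (T0 : 0 < T) (fBV : BV T f).

Let V := fine (variation_on f `[0%R, T]).

Let chain_sum_bound t (s : nat -> R) m : t <= T -> chain 0 t s -> chain_sum f s m <= V.
Proof.
move=> tT /(chain_widen tT) sc.
have := chain_sum_le_variation f m T0 sc; move: (fBV : (_ < _)%E); rewrite /V.
by case: (variation_on _ _).
Qed.

Let var_has_sup t : 0 <= t -> t <= T ->
  has_sup [set S | exists p m, chain 0 t p /\ S = chain_sum f p m].
Proof.
move=> t0 tT; split.
  by exists (chain_sum f (fun=> 0) 0), (fun=> 0), 0%N; split => // j.
by exists V => _ [s [m [sc ->]]]; exact: chain_sum_bound sc.
Qed.

Lemma chain_sum_le_var t (s : nat -> R) m : 0 <= t -> t <= T -> chain 0 t s ->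
  chain_sum f s m <= var f t.
Proof.
move=> t0 tT sc; apply: ub_le_sup; last by exists s, m.
by have [] := var_has_sup t0 tT.
Qed.

Lemma var_le_fine : ((var f T)%:E <= variation_on f `[0%R, T])%E.
Proof.
have -> : variation_on f `[0%R, T] = V%:E.
  have := chain_sum_le_variation f 0 T0 (_ : chain 0 T (fun=> 0)).
  rewrite /V; move: (fBV : (_ < _)%E).
  case: (variation_on _ _) => //= _ /(_ _)/wrap[]//.
  by move=> j; rewrite lexx ltW.
rewrite lee_fin; apply: ge_sup; first by have [] := var_has_sup (ltW T0) (lexx T).
by move=> _ [s [m [sc ->]]]; exact: chain_sum_bound sc.
Qed.

Lemma var_dominates : dominates 0 T f (var f).
Proof.
move=> s t s0 st tT; have t0 := le_trans s0 st; have sT := le_trans st tT.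
rewrite lerBrDl -lerBrDr; apply: ge_sup.
  by have [] := var_has_sup s0 sT.
move=> _ [p [m [pc ->]]]; rewrite lerBrDr.
pose q j := if (j <= m)%N then p j else if (j == m.+1)%N then s else t.
have qc : chain 0 t q.
  move=> j; have [p0 ps pp] := pc j; rewrite /q.
  have [jm|mj] := leqP j m.
    split => //; first exact: le_trans st.
    by case: leqP => // mj; rewrite eqSS eqn_leq jm mj.
  rewrite leqNgt (leqW mj)/= eqSS (gtn_eqF mj).
  by case: ifP.
apply: le_trans (chain_sum_le_var m.+2 t0 tT qc).
have qs : q m.+1 = s by rewrite /q ltnn eqxx.
have qt : q m.+2 = t by rewrite /q ltnNge leqnSn/= eqn_leq ltnn.
rewrite /chain_sum !big_ord_recr/= qs qt lerD2r -[leLHS]addr0 lerD//.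
by apply: ler_sum => j _; rewrite /q (ltn_ord j) ltnW.
Qed.

Lemma var0 : var f 0 = 0.
Proof.
apply/eqP; rewrite eq_le; apply/andP; split; last first.
  have := @chain_sum_le_var 0 (fun=> 0) 0%N (lexx _) (ltW T0) (fun=> _).
  by rewrite /chain_sum big_ord0; apply.
apply: ge_sup; first by have [] := var_has_sup (lexx 0) (ltW T0).
move=> _ [p [m [pc ->]]]; rewrite /chain_sum big1// => j _.
have pE i : p i = 0 by have [? ? _] := pc i; apply/le_anti/andP.
by rewrite !pE subrr normr0.
Qed.

(** The function that follows [var f] up to [a] and then the increments of [G]
    also dominates [f], and no chain sum exceeds the increment of a dominating
    function. *)
Lemma var_least a b G : 0 <= a -> a <= b -> b <= T -> dominates a b f G ->
  var f b - var f a <= G b - G a.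
Proof.
move=> a0 ab bT fG; have b0 := le_trans a0 ab.
pose G' t := if t <= a then var f t else var f a + (G t - G a).
have fG' : dominates 0 b f G'.
  move=> s t s0 st tb; rewrite /G'; have [ta|at_] := leP t a.
    rewrite (le_trans st ta); apply: var_dominates => //.
    exact: le_trans bT.
  have [sa|as_] := leP s a; last first.
    rewrite (_ : _ - _ = G t - G s); last by ring.
    by apply: fG => //; exact: ltW.
  have -> : f t - f s = (f a - f s) + (f t - f a).
    by rewrite [RHS]addrC addrA subrK.
  apply: le_trans (ler_normD _ _) _.
  rewrite addrAC; apply: lerD; last by apply: fG => //; exact: ltW.
  by apply: var_dominates => //; exact: le_trans bT.
have [<-|ab'] := eqVneq a b; first by rewrite !subrr.
have -> : var f a = G' a by rewrite /G' lexx.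
have G'b : G' b = var f a + (G b - G a).
  by rewrite /G' leNgt lt_neqAle ab' ab.
have G'0 : G' 0 = 0 by rewrite /G' a0 var0.
suff : var f b <= G' b - G' 0 by rewrite G'b G'0 /G' lexx; lra.
apply: ge_sup; first by have [] := var_has_sup b0 bT.
by move=> _ [p [m [pc ->]]]; exact: chain_sum_le pc.
Qed.

Lemma var_homo s t : 0 <= s -> s <= t -> t <= T -> var f s <= var f t.
Proof. exact: dominates_homo var_dominates s t. Qed.

(** If the variation jumped by [e] at the boundary of the up-set [U], while [f]
    does not jump there, then lowering the variation by [e] on [U] would still
    give a function that dominates [f], against minimality. *)
Let no_jump (U : pred R) (e : R) : 0 < e -> ~~ U 0 -> U T ->
  (forall s t, s <= t -> U s -> U t) ->
  ~ (forall s t eta, 0 <= s -> s <= t -> t <= T -> ~~ U s -> U t -> 0 < eta ->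
     `|f t - f s| <= var f t - var f s - e + eta).
Proof.
move=> e0 U0 UT Uup jump.
pose G t := var f t - (if U t then e else 0).
have fG : dominates 0 T f G.
  move=> s t s0 st tT; rewrite /G.
  case Us : (U s); case Ut : (U t).
  - by rewrite opprB addrA subrK; apply: var_dominates.
  - by move: Ut; rewrite (Uup _ _ st Us).
  - rewrite subr0 addrAC; apply/ler_addgt0Pr => eta eta0.
    by apply: jump; rewrite ?Us.
  - by rewrite !subr0; apply: var_dominates.
have := var_least (lexx _) (ltW T0) (lexx _) fG.
by rewrite /G (negbTE U0) UT; lra.
Qed.

Hypothesis fcont : {within `[0, T], continuous f}.

Let fcont_eps t e : 0 <= t -> t <= T -> 0 < e -> exists2 d, 0 < d &
  forall s, 0 <= s -> s <= T -> `|s - t| < d -> `|f s - f t| <= e.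
Proof.
move=> t0 tT e0; have /subspace_continuousP/(_ t) := fcont.
rewrite /= in_itv/= t0 tT => /(_ isT) /cvgrPdist_le/(_ _ e0).
rewrite near_withinE => /nbhs_ballP[d /= d0 dP]; exists d => // s s0 sT sd.
rewrite distrC; apply: dP; first by rewrite /ball/= distrC.
by rewrite /= in_itv/= s0.
Qed.

(** Otherwise [var f] jumps by [e] immediately after [t], and an increment of [f]
    across [t] can be split at points [r] just after [t], so that the jump is not
    counted. *)
Let var_right t e : 0 <= t -> t < T -> 0 < e -> exists s,
  [/\ t < s, s <= T & var f s <= var f t + e].
Proof.
move=> t0 tT e0; apply: contrapT => /forallNP noS.
have jump s : t < s -> s <= T -> var f t + e < var f s.
  by move=> ts sT; rewrite ltNge; apply/negP => ?; apply: (noS s); split.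
apply: (@no_jump (fun s => t < s) e) => //; first by rewrite -leNgt.
  by move=> s s' ss' /lt_le_trans; apply.
move=> s s' eta s0 ss' s'T; rewrite -leNgt => st ts' eta0.
have [d d0 dP] := fcont_eps t0 (ltW tT) eta0.
pose r := Num.min (t + d / 2) s'.
have tr : t < r by rewrite lt_min ts' ltrDl divr_gt0.
have rs' : r <= s' by rewrite ge_min lexx orbT.
have rd : `|r - t| < d.
  rewrite gtr0_norm ?subr_gt0// ltrBlDr; apply: (@le_lt_trans _ _ (t + d / 2)).
    by rewrite ge_min lexx.
  by rewrite addrC ltrD2r ltr_pdivrMr// ltr_pMr// ltr1n.
have r0 := le_trans t0 (ltW tr); have rT := le_trans rs' s'T.
have := dP _ r0 rT rd; have := var_dominates r0 rs' s'T.
have := var_dominates s0 st (ltW tT); have := jump _ tr rT.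
have -> : f s' - f s = (f s' - f r) + (f r - f t) + (f t - f s).
  by rewrite !addrA !subrK.
have := ler_normD ((f s' - f r) + (f r - f t)) (f t - f s).
have := ler_normD (f s' - f r) (f r - f t).
lra.
Qed.

Let var_left t e : 0 < t -> t <= T -> 0 < e -> exists s,
  [/\ 0 <= s, s < t & var f t - e <= var f s].
Proof.
move=> t0 tT e0; apply: contrapT => /forallNP noS.
have jump s : 0 <= s -> s < t -> var f s < var f t - e.
  by move=> ts sT; rewrite ltNge; apply/negP => ?; apply: (noS s); split.
apply: (@no_jump (fun s => t <= s) e) => //; first by rewrite -ltNge.
  by move=> s s' ss' /le_trans; apply.
move=> s s' eta s0 ss' s'T; rewrite -ltNge => st ts' eta0.
have [d d0 dP] := fcont_eps (ltW t0) tT eta0.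
pose r := Num.max (t - d / 2) s.
have tr : r < t by rewrite gt_max st gtrBl divr_gt0.
have rs' : s <= r by rewrite le_max lexx orbT.
have rd : `|r - t| < d.
  rewrite distrC gtr0_norm ?subr_gt0// ltrBlDr -ltrBlDl.
  apply: (@lt_le_trans _ _ (t - d / 2)); last by rewrite le_max lexx.
  by rewrite ltrD2l ltrN2 ltr_pdivrMr// ltr_pMr// ltr1n.
have r0 := le_trans s0 rs'; have rT := le_trans (ltW tr) tT.
have := dP _ r0 rT rd; have := var_dominates s0 rs' rT.
have := var_dominates (ltW t0) ts' s'T; have := jump _ r0 tr.
have -> : f s' - f s = (f s' - f t) + (f t - f r) + (f r - f s).
  by rewrite !addrA !subrK.
have := ler_normD ((f s' - f t) + (f t - f r)) (f r - f s).
have := ler_normD (f s' - f t) (f t - f r).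
rewrite (distrC (f r) (f t)).
lra.
Qed.

Lemma var_clamp_homo s t : s <= t ->
  var f (clamp T s) <= var f (clamp T t).
Proof.
move=> st; apply: var_homo; rewrite ?clamp_ge0 ?clamp_le ?(ltW T0)//.
exact: clamp_homo.
Qed.

(** The clamped variation is a nondecreasing continuous function on the whole
    line, as needed for a Stieltjes measure. *)
Lemma var_clamp_continuous : continuous (fun t => var f (clamp T t)).
Proof.
move=> t; apply/cvgrPdist_le => e e0.
have [d1 d10 d1P] : exists2 d, 0 < d & forall s, s <= t + d ->
    var f (clamp T s) <= var f (clamp T t) + e.
  have [tT|Tt] := ltP t T; last first.
    exists 1 => // s _; rewrite (clampT (ltW T0) Tt).
    apply: ler_wpDr; first exact: ltW.
    by apply: var_homo; rewrite ?clamp_ge0 ?clamp_le ?(ltW T0).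
  have [t0|t0] := ltP t 0.
    exists (- t); first by rewrite oppr_gt0.
    move=> s; rewrite subrr => s0; rewrite (clamp0 (ltW T0) s0) (clamp0 (ltW T0) (ltW t0)).
    by rewrite lerDl ltW.
  have [s [ts sT sP]] := var_right t0 tT e0.
  exists (s - t); first by rewrite subr_gt0.
  move=> s'; rewrite subrKC => /var_clamp_homo/le_trans; apply.
  by rewrite (clamp_id t0 (ltW tT)) (clamp_id (le_trans t0 (ltW ts)) sT).
have [d2 d20 d2P] : exists2 d, 0 < d & forall s, t - d <= s ->
    var f (clamp T t) - e <= var f (clamp T s).
  have [t0|t0] := leP t 0.
    exists 1 => // s _; rewrite (clamp0 (ltW T0) t0) var0 sub0r.
    apply: (@le_trans _ _ 0); first by rewrite oppr_le0 ltW.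
    by rewrite -[leLHS]var0; apply: var_homo; rewrite ?clamp_ge0 ?clamp_le ?(ltW T0).
  have [tT|Tt] := leP t T; last first.
    exists (t - T); first by rewrite subr_gt0.
    move=> s; rewrite subKr => Ts; rewrite (clampT (ltW T0) Ts) (clampT (ltW T0) (ltW Tt)).
    by rewrite gerBl ltW.
  have [s [s0 st sP]] := var_left t0 tT e0.
  exists (t - s); first by rewrite subr_gt0.
  move=> s'; rewrite subKr => /var_clamp_homo; apply: le_trans.
  by rewrite (clamp_id (ltW t0) tT) (clamp_id s0 (le_trans (ltW st) tT)).
apply/nbhs_ballP; exists (Num.min d1 d2) => [|s] /=; first by rewrite lt_min d10.
rewrite lt_min => /andP[]; rewrite !ltr_distl => /andP[ts1 _] /andP[_ ts2].
have sd1 : s <= t + d1 by lra.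
have sd2 : t - d2 <= s by lra.
by have := d1P _ sd1; have := d2P _ sd2; rewrite ler_distl; lra.
Qed.

Lemma partition_near_var e : 0 < e -> exists p m,
  [/\ chain 0 T p, p 0%N = 0, p m = T & var f T - e < chain_sum f p m].
Proof.
move=> e0; have [_ [p [m [pc ->]]] pe] := sup_adherent e0
  (var_has_sup (ltW T0) (lexx T)).
pose q j := if j is j'.+1 then (if (j' <= m)%N then p j' else T) else 0.
exists q, m.+2; split => //; last 2 first.
- by rewrite /q ltnn.
- apply: lt_le_trans pe _; rewrite /chain_sum big_ord_recl big_ord_recr/=.
  rewrite -[leLHS]add0r; apply: lerD => //; rewrite -[leLHS]addr0; apply: lerD => //.
  apply: ler_sum => j _; have jm := ltn_ord j.
  by rewrite /bump leq0n add1n add0n jm (ltnW jm).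
move=> [|j]; rewrite /q/=.
  by have [p0 pT _] := pc 0%N; split => //; exact: ltW.
have [p0 pT pp] := pc j; by case: (ltnP j m) => [jm|_]; first (by rewrite ltnW); case: ifP; split => //; exact: ltW.
Qed.

End bounded.
End variation.

(** Inverting a strictly increasing continuous gauge: [tau] runs through
    [[a, b]] with constant speed with respect to [mu]. *)
Lemma equal_division {R : realType} (mu : R -> R) (a b : R) : a <= b ->
  continuous mu -> (forall s t, s < t -> mu s < mu t) ->
  exists tau : R -> R, [/\ tau 0 = a, tau 1 = b,
    forall s, 0 <= s -> s <= 1 -> mu (tau s) = mu a + s * (mu b - mu a) &
    forall s t, 0 <= s -> s <= t -> t <= 1 ->
      [/\ a <= tau s, tau s <= tau t & tau t <= b]].
Proof.
move=> ab muc muinc.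
have mule s t : (mu s <= mu t) = (s <= t).
  have [st|ts|->] := ltgtP s t; rewrite ?lexx//.
    exact/ltW/muinc.
  by apply/negbTE; rewrite -ltNge muinc.
have muab : mu a <= mu b by rewrite mule.
have value s : exists c, 0 <= s -> s <= 1 ->
    [/\ a <= c, c <= b & mu c = mu a + s * (mu b - mu a)].
  have [s0|s0] := leP 0 s; last by exists a.
  have [s1|s1] := leP s 1; last by exists a.
  have [|c] := @IVT R mu a b (mu a + s * (mu b - mu a)) ab
      (continuous_subspaceT muc).
    rewrite min_l// max_r// lerDl mulr_ge0 ?subr_ge0//=.
    by rewrite -lerBrDl ler_piMl// subr_ge0.
  by rewrite in_itv => /andP[ac cb] cE; exists c.
have [tau tauP] := choice value; exists tau.
have tau01 s t : 0 <= s -> s <= t -> t <= 1 -> tau s <= tau t.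
  move=> s0 st t1; rewrite -mule.
  have [_ _ ->] := tauP s s0 (le_trans st t1).
  have [_ _ ->] := tauP t (le_trans s0 st) t1.
  by rewrite lerD2l ler_wpM2r// subr_ge0.
split.
- have [a0 _ mua] := tauP 0 (lexx _) ler01.
  by apply/eqP; rewrite eq_le a0 -mule mua mul0r addr0 lexx.
- have [_ b0 mub] := tauP 1 ler01 (lexx _).
  by apply/eqP; rewrite eq_le b0 -mule mub mul1r subrKC lexx.
- by move=> s s0 s1; have [] := tauP s s0 s1.
- move=> s t s0 st t1; have [? _ _] := tauP s s0 (le_trans st t1).
  have [_ ? _] := tauP t (le_trans s0 st) t1.
  by split => //; exact: tau01.
Qed.

(** * Orthogonality of the increments at small scale *)

Lemma sum_ord_mul {V : nmodType} (F : nat -> V) N m :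
  \sum_(i < N * m) F i = \sum_(j < N) \sum_(i < m) F (j * m + i)%N.
Proof.
rewrite -(big_mkord xpredT) big_nat_mul big_mkord; apply: eq_bigr => j _.
rewrite -[X in \sum_(X <= _ < _) _]add0n big_addn big_mkord.
rewrite mulSn addnK; apply: eq_bigr => i _.
by rewrite addnC.
Qed.

Section finite_sequences.
Context {R : realType} {H : normedModType R} (dot : {dot H for idfun}).
Hypothesis dot_norm : forall x : H, dot x x = `|x| ^+ 2.
Variables (m : nat).
Hypothesis m_gt0 : (0 < m)%N.
Implicit Types x y : nat -> H.

Let mR : 0 < (m%:R : R). Proof. by rewrite ltr0n. Qed.

Definition mean_step x : H := m%:R^-1 *: (x m - x 0%N).

Definition deviation x i : H := x i.+1 - x i - mean_step x.

Lemma stepE x i : x i.+1 - x i = mean_step x + deviation x i.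
Proof. by rewrite /deviation subrKC. Qed.

Lemma sum_step x n : \sum_(i < n) (x i.+1 - x i) = x n - x 0%N.
Proof.
by rewrite -(big_mkord xpredT (fun i => x i.+1 - x i)) telescope_sumr.
Qed.

Lemma sum_deviation_prefix x n :
  \sum_(i < n) deviation x i = x n - x 0%N - n%:R *: mean_step x.
Proof.
by rewrite /deviation sumrB sum_step sumr_const card_ord scaler_nat.
Qed.

Lemma mean_stepK x : m%:R *: mean_step x = x m - x 0%N.
Proof. by rewrite /mean_step scalerA divff ?scale1r ?lt0r_neq0. Qed.

Lemma norm_mean_step x : m%:R * `|mean_step x| = `|x m - x 0%N|.
Proof. by rewrite -mean_stepK [RHS]normrZ (gtr0_norm mR). Qed.

(** The steps have their mean as orthogonal projection onto constant
    sequences. *)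
Lemma sum_sqr_step x : \sum_(i < m) `|x i.+1 - x i| ^+ 2 =
  `|x m - x 0%N| ^+ 2 / m%:R + \sum_(i < m) `|deviation x i| ^+ 2.
Proof.
under eq_bigr do rewrite stepE (normD_sqr dot_norm).
rewrite 2!big_split/= -[X in _ + X + _]mulr_sumr -dot_sumr sum_deviation_prefix mean_stepK.
rewrite subrr dot0r mulr0 addr0 sumr_const card_ord; congr (_ + _).
by rewrite -norm_mean_step -[LHS]mulr_natl; field; exact: lt0r_neq0.
Qed.

Lemma sum_symmetric_weights n :
  \sum_(i < n) (n%:R - 2 * i%:R) = n%:R :> R.
Proof.
rewrite sumrB sumr_const card_ord -mulr_sumr.
elim: n => [|n IH]; first by rewrite big_ord0; ring.
rewrite big_ord_recr/= -mulr_natr; move: IH; rewrite -mulr_natr.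
by rewrite -natr1 => IH; lra.
Qed.

(** The weights of the two one-sided Riemann sums of [dot x dy] differ by
    terms that cancel when [x] and [y] are affine. *)
Lemma riemann_sums_difference x y :
  `|\sum_(i < m) dot (x m - x i) (y i.+1 - y i) -
    \sum_(i < m) dot (x i - x 0%N) (y i.+1 - y i)| <=
  `|x m - x 0%N| * `|y m - y 0%N| / m%:R +
  `|x m - x 0%N| * (\sum_(i < m) `|deviation y i|) +
  2 * (\sum_(i < m) `|deviation x i|) * \sum_(i < m) `|y i.+1 - y i|.
Proof.
pose Sx := \sum_(i < m) `|deviation x i|.
pose E i := \sum_(k < i) deviation x k.
have E_le (i : 'I_m) : `|E i| <= Sx.
  apply: le_trans (ler_norm_sum _ _ _) _.
  rewrite /Sx -(big_mkord xpredT (fun k => `|deviation x k|)).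
  rewrite -(big_mkord xpredT (fun k => `|deviation x k|)).
  rewrite [leRHS](big_cat_nat (leq0n i) (ltnW (ltn_ord i)))/= lerDl.
  by apply: sumr_ge0.
have termE (i : 'I_m) : dot (x m - x i) (y i.+1 - y i) -
    dot (x i - x 0%N) (y i.+1 - y i) =
    (m%:R - 2 * i%:R) * dot (mean_step x) (mean_step y) +
    (m%:R - 2 * i%:R) * dot (mean_step x) (deviation y i) -
    2 * dot (E i) (y i.+1 - y i).
  have -> : x m - x i = (m%:R - i%:R) *: mean_step x - E i.
    rewrite /E sum_deviation_prefix scalerBl mean_stepK.
    by rewrite opprB addrA subrK opprB addrA subrK.
  have -> : x i - x 0%N = i%:R *: mean_step x + E i.
    by rewrite /E sum_deviation_prefix subrKC.
  rewrite dotBl dotDl (dotZl dot (m%:R - i%:R)) (dotZl dot i%:R).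
  have -> : dot (mean_step x) (y i.+1 - y i) =
      dot (mean_step x) (mean_step y) + dot (mean_step x) (deviation y i).
    by rewrite stepE dotDr.
  ring.
rewrite -sumrB; under eq_bigr do rewrite termE.
rewrite sumrB big_split/= -mulr_suml sum_symmetric_weights.
apply: le_trans (ler_normB _ _) _; apply: lerD; last first.
  apply: le_trans (ler_norm_sum _ _ _) _; rewrite mulr_sumr.
  apply: ler_sum => i _; rewrite normrM gtr0_norm// -mulrA ler_pM2l//.
  apply: le_trans (normr_dot_le dot_norm _ _) _.
  exact: ler_wpM2r.
apply: le_trans (ler_normD _ _) _; apply: lerD.
  rewrite normrM gtr0_norm// ler_pdivlMr//.
  rewrite -!norm_mean_step mulrACA -!mulrA ler_pM2l// mulrC ler_pM2l//.
  exact: normr_dot_le.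
apply: le_trans (ler_norm_sum _ _ _) _; rewrite mulr_sumr.
apply: ler_sum => i _; rewrite normrM -norm_mean_step -mulrA.
apply: ler_pM => //; last exact: normr_dot_le.
rewrite ler_norml; have : (i%:R <= m%:R :> R) by rewrite ler_nat ltnW.
by have : (0 <= i%:R :> R) by []; lra.
Qed.

(** Since the two Riemann sums add up to [dot (x m - x 0) (y m - y 0)] and are
    nearly equal, an upper bound for one and a lower bound for the other confine
    their sum. *)
Lemma dot_step_le x y (s : R) :
  \sum_(i < m) dot (x m - x i) (y i.+1 - y i) <= s ->
  \sum_(i < m) dot (x 0%N - x i) (y i.+1 - y i) <= s ->
  `|dot (x m - x 0%N) (y m - y 0%N)| <= 2 * s +
   (`|x m - x 0%N| * `|y m - y 0%N| / m%:R +
    `|x m - x 0%N| * (\sum_(i < m) `|deviation y i|) +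
    2 * (\sum_(i < m) `|deviation x i|) * \sum_(i < m) `|y i.+1 - y i|).
Proof.
move=> Ps Qs; apply: le_trans (lerD (lexx (2 * s)) (riemann_sums_difference x y)).
have -> : dot (x m - x 0%N) (y m - y 0%N) =
    \sum_(i < m) dot (x m - x i) (y i.+1 - y i) +
    \sum_(i < m) dot (x i - x 0%N) (y i.+1 - y i).
  rewrite -big_split/= -(sum_step y) dot_sumr; apply: eq_bigr => i _.
  by rewrite -dotDl addrA subrK.
have : - \sum_(i < m) dot (x i - x 0%N) (y i.+1 - y i) <= s.
  rewrite -sumrN; apply: le_trans Qs; apply: ler_sum => i _.
  by rewrite -dotNl opprB.
set P := \sum_(i < m) dot (x m - x i) (y i.+1 - y i) in Ps *.
set Q := \sum_(i < m) dot (x i - x 0%N) (y i.+1 - y i).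
have := ler_norm (P - Q); have := ler_norm (- (P - Q)).
by rewrite normrN => ? ? ?; rewrite ler_norml; lra.
Qed.

End finite_sequences.

Section small_scale.
Context {R : realType} {H : normedModType R} (dot : {dot H for idfun}).
Hypothesis dot_norm : forall x : H, dot x x = `|x| ^+ 2.
Implicit Types (X Y : R -> H) (N m i j : nat) (A B L : R).

Definition grid X N i : H := X (i%:R / N%:R).

Definition energy X N : R :=
  \sum_(i < N) N%:R * `|grid X N i.+1 - grid X N i| ^+ 2.

Let lipschitz01 L X := forall s t, 0 <= s -> s <= t -> t <= 1 ->
  `|X t - X s| <= L * (t - s).

Let fine_grid X N m j i : H := grid X (N * m) (j * m + i).

Let fine_grid0 X N m j : (0 < N)%N -> (0 < m)%N ->
  fine_grid X N m j 0 = grid X N j.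
Proof.
move=> N0 m0; rewrite /fine_grid addn0 /grid !natrM; congr X; field.
by rewrite !pnatr_eq0 -!lt0n N0 m0.
Qed.

Let fine_gridm X N m j : (0 < N)%N -> (0 < m)%N ->
  fine_grid X N m j m = grid X N j.+1.
Proof.
by move=> N0 m0; rewrite -(fine_grid0 X j.+1 N0 m0) /fine_grid addn0 mulSn addnC.
Qed.

Let fine_gridS X N m j i :
  grid X (N * m) (j * m + i).+1%N = fine_grid X N m j i.+1.
Proof. by rewrite /fine_grid addnS. Qed.

(** Refining a uniform partition increases the energy, exactly by the
    deviations of the small increments from their means. *)
Lemma energy_mul X N m : (0 < N)%N -> (0 < m)%N -> energy X (N * m) =
  energy X N + \sum_(j < N) (N * m)%:R *
     \sum_(i < m) `|deviation m (fine_grid X N m j) i| ^+ 2.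
Proof.
move=> N0 m0; rewrite /energy (sum_ord_mul (fun i => (N * m)%:R *
  `|grid X (N * m) i.+1 - grid X (N * m) i| ^+ 2)) -big_split/=.
apply: eq_bigr => j _; rewrite -mulr_sumr.
under [in LHS]eq_bigr do rewrite fine_gridS.
rewrite (sum_sqr_step dot_norm m0) fine_gridm// fine_grid0// mulrDr; congr (_ + _).
by rewrite natrM; field; rewrite pnatr_eq0 -lt0n.
Qed.

Let grid_point N i : (i <= N)%N -> 0 <= i%:R / N%:R :> R /\ i%:R / N%:R <= 1 :> R.
Proof.
move=> iN; split; first by rewrite divr_ge0.
have [->|N0] := posnP N; first by rewrite invr0 mulr0.
by rewrite ler_pdivrMr ?ltr0n// mul1r ler_nat.
Qed.

Let grid_step L X N i : lipschitz01 L X -> (i < N)%N ->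
  `|grid X N i.+1 - grid X N i| <= L / N%:R.
Proof.
move=> XL iN; have [? _] := grid_point (ltnW iN); have [_ ?] := grid_point iN.
have N0 : 0 < N%:R :> R by rewrite ltr0n (leq_ltn_trans _ iN).
have -> : L / N%:R = L * (i.+1%:R / N%:R - i%:R / N%:R).
  by rewrite -mulrBl -natrB// subSnn mul1r.
by apply: XL => //; rewrite ler_pM2r ?invr_gt0// ler_nat.
Qed.

Lemma energy_le L X N : 0 <= L -> lipschitz01 L X -> (0 < N)%N ->
  energy X N <= L ^+ 2.
Proof.
move=> L0 XL N0; have NR : 0 < N%:R :> R by rewrite ltr0n.
apply: (@le_trans _ _ (\sum_(i < N) L ^+ 2 / N%:R)).
  apply: ler_sum => i _.
  apply: (@le_trans _ _ (N%:R * (L / N%:R) ^+ 2)).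
    rewrite ler_pM2l// ler_sqr ?nnegrE ?divr_ge0//.
    exact: grid_step.
  rewrite le_eqVlt; apply/orP; left; apply/eqP; field; exact: lt0r_neq0.
rewrite sumr_const card_ord -[leLHS]mulr_natl mulrCA divff ?mulr1//.
exact: lt0r_neq0.
Qed.

(** The energy controls the squares of the deviations; the inequality between
    arithmetic and geometric means turns this into a bound on their sum. *)
Let sum_deviation_le X N m eta : (0 < N)%N -> (0 < m)%N -> 0 < eta ->
  energy X (N * m) - energy X N <= eta ^+ 2 ->
  \sum_(j < N) \sum_(i < m) `|deviation m (fine_grid X N m j) i| <= 2 * eta.
Proof.
move=> N0 m0 eta0 XE; have M0 : 0 < (N * m)%:R :> R by rewrite ltr0n muln_gt0 N0.
have step (v : H) : `|v| <= eta / (N * m)%:R + ((N * m)%:R * `|v| ^+ 2) / eta.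
  move: ((N * m)%:R : R) M0 => M M0.
  have -> : eta / M + M * `|v| ^+ 2 / eta = `|v| +
      ((eta - M * `|v|) ^+ 2 + eta * M * `|v|) / (eta * M).
    by field; rewrite !lt0r_neq0.
  rewrite lerDl divr_ge0 ?addr_ge0 ?sqr_ge0 ?mulr_ge0//; exact: ltW.
apply: (@le_trans _ _ (\sum_(j < N) \sum_(i < m) (eta / (N * m)%:R +
   (N * m)%:R * `|deviation m (fine_grid X N m j) i| ^+ 2 / eta))).
  by apply: ler_sum => j _; apply: ler_sum => i _.
under eq_bigr do rewrite big_split/= sumr_const card_ord -mulr_suml -mulr_sumr.
rewrite big_split/= sumr_const card_ord -mulrnA [(m * N)%N]mulnC -mulr_suml.
rewrite (_ : \sum_(j < N) _ = energy X (N * m) - energy X N); last first.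
  by rewrite energy_mul// [in RHS]addrC addKr.
rewrite -[eta / _ *+ _]mulr_natl mulrCA divff ?mulr1 ?lt0r_neq0//.
have -> : 2 * eta = eta + eta by ring.
by rewrite lerD2l ler_pdivrMr.
Qed.

(** The hypothesis on [dot (X p - X a) (Y b - Y a)] is a second order inequality:
    on an interval of length [1 / N] cut into [m] parts it sums up to a term of
    order [1 / N ^ 3 + 1 / (N ^ 2 * m)], whereas an increment of [X] paired with
    one of [Y] has order [1 / N ^ 2]. Taking [p] at either end of the interval
    bounds both Riemann sums of [dot_step_le]. *)
Lemma small_scale_orthogonality X Y A B L : 0 <= A -> 0 <= B -> 0 < L ->
  lipschitz01 L X -> lipschitz01 L Y ->
  (forall a b p D, 0 <= a -> a <= b -> b <= 1 -> 0 <= p -> p <= 1 ->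
     (forall s, a <= s -> s <= b -> `|p - s| <= D) ->
     dot (X p - X a) (Y b - Y a) <= (A * D ^+ 2 + B * (b - a)) * (b - a)) ->
  forall e, 0 < e -> exists N, (0 < N)%N /\
    \sum_(i < N) N%:R * `|dot (grid X N i.+1 - grid X N i)
                              (grid Y N i.+1 - grid Y N i)| <= e.
Proof.
move=> A0 B0 L0 XL YL VI e e0.
pose eta := e / (18 * L).
have eta0 : 0 < eta by rewrite divr_gt0// mulr_gt0.
pose E N := energy X N + energy Y N.
pose S := [set E N | N in [set N | (0 < N)%N]].
have Ssup : has_sup S.
  split; first by exists (E 1%N), 1%N.
  exists (L ^+ 2 + L ^+ 2) => _ [N N0 <-].
  by apply: lerD; apply: energy_le => //; exact: ltW.
(* From [N1] on, every refinement changes the energy by at most [eta ^ 2]. *)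
have [_ [N1 N10 <-] N1E] := sup_adherent (exprn_gt0 2 eta0) Ssup.
(* [N2] makes the cubic error small, and [m] the error of the Riemann sums. *)
have [N2 N20 N2P] : exists2 N, (0 < N)%N & 6 * A / e <= N%:R.
  exists (Num.truncn (6 * A / e)).+1 => //; exact/ltW/truncnS_gt.
have [m m0 mP] : exists2 m, (0 < m)%N & 3 * (2 * B + L ^+ 2) / e <= m%:R.
  exists (Num.truncn (3 * (2 * B + L ^+ 2) / e)).+1 => //; exact/ltW/truncnS_gt.
pose N := (N1 * N2)%N.
have N0 : (0 < N)%N by rewrite muln_gt0 N10.
have N2N : (N2%:R <= N%:R :> R) by rewrite ler_nat leq_pmull.
have energy_incr Z N' m' : (0 < N')%N -> (0 < m')%N ->
    energy Z N' <= energy Z (N' * m').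
  move=> ? ?; rewrite energy_mul// lerDl sumr_ge0// => j _.
  by rewrite mulr_ge0// sumr_ge0.
have XE : energy X (N * m) - energy X N <= eta ^+ 2.
  have : E (N * m)%N <= sup S.
    by apply: ub_le_sup; [case: Ssup|exists (N * m)%N => //=; rewrite muln_gt0 N0].
  have := energy_incr X _ _ N10 N20; have := energy_incr Y _ _ N10 N20.
  by have := energy_incr Y _ _ N0 m0; move: N1E; rewrite /E -/N; lra.
have YE : energy Y (N * m) - energy Y N <= eta ^+ 2.
  have : E (N * m)%N <= sup S.
    by apply: ub_le_sup; [case: Ssup|exists (N * m)%N => //=; rewrite muln_gt0 N0].
  have := energy_incr X _ _ N10 N20; have := energy_incr Y _ _ N10 N20.
  by have := energy_incr X _ _ N0 m0; move: N1E; rewrite /E -/N; lra.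
have NR : 0 < N%:R :> R by rewrite ltr0n.
have mR : 0 < m%:R :> R by rewrite ltr0n.
exists N; split => //.
pose s := (A / N%:R ^+ 2 + B / (N%:R * m%:R)) / N%:R.
pose SX j := \sum_(i < m) `|deviation m (fine_grid X N m j) i|.
pose SY j := \sum_(i < m) `|deviation m (fine_grid Y N m j) i|.
have coarse (j : 'I_N) :
   N%:R * `|dot (grid X N j.+1 - grid X N j) (grid Y N j.+1 - grid Y N j)| <=
   (2 * A / N%:R + (2 * B + L ^+ 2) / m%:R) / N%:R + L * SY j + 2 * L * SX j.
  have jiN i : (i < m)%N -> (j * m + i < N * m)%N.
    move=> im; apply: (@leq_trans (j.+1 * m)%N); last by rewrite leq_mul2r ltn_ord orbT.
    by rewrite mulSn addnC ltn_add2r.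
  have onesided p : (p == j :> nat) || (p == j.+1 :> nat) ->
     \sum_(i < m) dot (grid X N p - fine_grid X N m j i)
       (fine_grid Y N m j i.+1 - fine_grid Y N m j i) <= s.
    move=> pj; apply: (@le_trans _ _ (\sum_(i < m) s / m%:R)); last first.
      by rewrite sumr_const card_ord -[leLHS]mulr_natr divfK// lt0r_neq0.
    apply: ler_sum => i _; rewrite -fine_gridS /fine_grid /grid.
    have jim := jiN _ (ltn_ord i).
    have [a0 _] := grid_point (ltnW jim).
    have [_ b1] := grid_point jim.
    have pN : (p <= N)%N by case/orP: pj => /eqP->; rewrite ?ltn_ord// ltnW.
    have [p0 p1] := grid_point pN.
    set a : R := _ / _ in a0 *; set b : R := _ / _ in b1 *.
    have ba : b - a = (N%:R * m%:R)^-1.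
      by rewrite /a /b -mulrBl -natrB// subSnn mul1r natrM.
    have ab : a <= b by rewrite -subr_ge0 ba invr_ge0 mulr_ge0.
    apply: le_trans (VI a b _ (N%:R^-1) a0 ab b1 p0 p1 _) _; last first.
      rewrite ba le_eqVlt /s; apply/orP; left; apply/eqP.
      by field; rewrite !lt0r_neq0.
    have ja : j%:R / N%:R <= a.
      rewrite /a natrD natrM [X in _ <= _ / X]natrM.
      rewrite ler_pdivlMr ?mulr_gt0// mulrA divfK ?lt0r_neq0// ?lerDl//.
    have jb : b <= j.+1%:R / N%:R.
      rewrite /b [X in _ / X]natrM ler_pdivrMr ?mulr_gt0// mulrA.
      rewrite divfK ?lt0r_neq0// -natrM ler_nat.
      by rewrite mulSn -addnS addnC leq_add2r ltn_ord.
    have j1 : j.+1%:R / N%:R = j%:R / N%:R + N%:R^-1 :> R.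
      by rewrite -natr1 mulrDl mul1r.
    have Ni : 0 <= N%:R^-1 :> R by rewrite invr_ge0.
    move=> t at_ tb; rewrite ler_norml; case/orP: pj => /eqP->; lra.
  have := @dot_step_le R H dot dot_norm m m0 (fine_grid X N m j)
    (fine_grid Y N m j) s.
  rewrite !fine_gridm// !fine_grid0// => /(_ (onesided _ _) (onesided _ _)).
  rewrite !eqxx orbT => /(_ isT isT) dle.
  have Xj := grid_step XL (ltn_ord j); have Yj := grid_step YL (ltn_ord j).
  have LN : 0 <= L / N%:R by rewrite divr_ge0// ltW.
  have SX0 : 0 <= SX j by exact: sumr_ge0.
  have SY0 : 0 <= SY j by exact: sumr_ge0.
  have sumY : \sum_(i < m) `|fine_grid Y N m j i.+1 - fine_grid Y N m j i| <=
      L / N%:R.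
    apply: (@le_trans _ _ (\sum_(i < m) L / (N * m)%:R)).
      apply: ler_sum => i _; rewrite -fine_gridS; apply: grid_step => //.
      exact: jiN.
    rewrite sumr_const card_ord -[leLHS]mulr_natl natrM le_eqVlt.
    by apply/orP; left; apply/eqP; field; rewrite !lt0r_neq0.
  rewrite mulrC -ler_pdivlMr//; apply: le_trans dle _.
  have -> : ((2 * A / N%:R + (2 * B + L ^+ 2) / m%:R) / N%:R + L * SY j +
      2 * L * SX j) / N%:R = 2 * s + ((L / N%:R) * (L / N%:R) / m%:R +
        L / N%:R * SY j + 2 * SX j * (L / N%:R)).
    by rewrite /s; field; rewrite !lt0r_neq0.
  rewrite lerD2l; apply: lerD; first apply: lerD.
  - by rewrite ler_pM2r ?invr_gt0//; apply: ler_pM.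
  - exact: ler_wpM2r.
  - by apply: ler_wpM2l; rewrite ?mulr_ge0.
apply: (@le_trans _ _ (\sum_(j < N) ((2 * A / N%:R + (2 * B + L ^+ 2) / m%:R) /
    N%:R + L * SY j + 2 * L * SX j))).
  by apply: ler_sum => j _; exact: coarse.
rewrite 2!big_split/= sumr_const card_ord -!mulr_sumr.
have SXle : \sum_(j < N) SX j <= 2 * eta by exact: sum_deviation_le.
have SYle : \sum_(j < N) SY j <= 2 * eta by exact: sum_deviation_le.
rewrite -[X in X + _ + _]mulr_natr divfK ?lt0r_neq0//.
have AN : 2 * A / N%:R <= e / 3.
  rewrite ler_pdivrMr//; move: (le_trans N2P N2N); rewrite ler_pdivrMr//; lra.
have Bm : (2 * B + L ^+ 2) / m%:R <= e / 3.
  by rewrite ler_pdivrMr//; move: mP; rewrite ler_pdivrMr//; lra.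
have : L * \sum_(j < N) SY j <= L * (2 * eta) by rewrite ler_pM2l.
have : 2 * L * \sum_(j < N) SX j <= 2 * L * (2 * eta).
  by rewrite ler_pM2l// mulr_gt0.
have : 6 * L * eta = e / 3 by rewrite /eta; field; exact: lt0r_neq0.
lra.
Qed.

(** If the increments of [X] and [Y] are orthogonal at small scale, the
    increments of [X - Y] are as long as those of [X + Y]. *)
Lemma dominates_sub_of_add X Y G :
  (forall e, 0 < e -> exists N, (0 < N)%N /\
    \sum_(i < N) N%:R * `|dot (grid X N i.+1 - grid X N i)
                              (grid Y N i.+1 - grid Y N i)| <= e) ->
  dominates 0 1 (X \+ Y) G ->
  `|(X 1 - Y 1) - (X 0 - Y 0)| <= G 1 - G 0.
Proof.
move=> orth XYG; apply/ler_addgt0Pr => e e0.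
pose eta := e / 2.
have eta0 : 0 < eta by rewrite divr_gt0.
have [N [N0 Nle]] := orth _ (exprn_gt0 2 eta0).
have NR : 0 < N%:R :> R by rewrite ltr0n.
pose D i := X (i%:R / N%:R) - Y (i%:R / N%:R).
have -> : X 1 - Y 1 - (X 0 - Y 0) = D N - D 0%N.
  by rewrite /D divff ?lt0r_neq0// mul0r.
rewrite -sum_step; apply: le_trans (ler_norm_sum _ _ _) _.
pose P i := `|X (i.+1%:R / N%:R) + Y (i.+1%:R / N%:R) -
  (X (i%:R / N%:R) + Y (i%:R / N%:R))|.
pose Q i := `|dot (grid X N i.+1 - grid X N i) (grid Y N i.+1 - grid Y N i)|.
apply: (@le_trans _ _ (\sum_(i < N) (P i + eta / N%:R + (N%:R * Q i) / eta))).
  apply: ler_sum => i _; rewrite /D.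
  have -> : X (i.+1%:R / N%:R) - Y (i.+1%:R / N%:R) -
     (X (i%:R / N%:R) - Y (i%:R / N%:R)) =
     (grid X N i.+1 - grid X N i) - (grid Y N i.+1 - grid Y N i).
    by rewrite /grid !opprB addrACA [in RHS]addrACA; congr (_ + _); rewrite addrC.
  have -> : P i = `|(grid X N i.+1 - grid X N i) + (grid Y N i.+1 - grid Y N i)|.
    by rewrite /P /grid opprD addrACA.
  have := normB_le_normD dot_norm (grid X N i.+1 - grid X N i)
    (grid Y N i.+1 - grid Y N i) (divr_gt0 eta0 NR).
  by rewrite invf_div mulrA [_ * N%:R]mulrC.
rewrite 2!big_split/= sumr_const card_ord -mulr_suml -[X in _ + X + _]mulr_natr.
rewrite divfK ?lt0r_neq0// -addrA; apply: lerD.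
  have := @dominates_sum_le R H 0 1 (X \+ Y) G (fun i => i%:R / N%:R) N XYG.
  rewrite divff ?lt0r_neq0// mul0r; apply.
    by move=> j jN; have [-> ->] := grid_point jN.
  by move=> j _; rewrite ler_pM2r ?invr_gt0// ler_nat.
have -> : e = eta + eta by rewrite /eta; field.
by rewrite lerD2l ler_pdivrMr.
Qed.

End small_scale.

(** * The total variation measure of a differential measure *)

Section stieltjes.
Context {R : realType}.

(** The measure is taken on the Borel sets of [R] itself, over which the variation
    of a vector measure is integrated. *)
Lemma stieltjes_measure_exists (g : R -> R) :
  {homo g : x y / x <= y} -> continuous g ->
  exists m : {measure set R -> \bar R},
    forall a b, a <= b -> m `]a, b]%classic = (g b - g a)%:E.
Proof.
move=> gh gc.
have [G GE] : exists G : cumulative R R, G = g :> (R -> R).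
  pose G : cumulative R R :=
    HB.pack g (isCumulative.Build R _ R g gh (right_continuousW gc)).
  by exists G.
pose m : set R -> \bar R := lebesgue_stieltjes_measure G.
have m0 : m set0 = 0%E by exact: measure0.
have mge0 A : (0 <= m A)%E by exact: measure_ge0.
have msig : semi_sigma_additive m.
  exact: (@measure_semi_sigma_additive _ _ _ (lebesgue_stieltjes_measure G)).
pose M : {measure set R -> \bar R} := HB.pack m (isMeasure.Build _ _ _ m m0 mge0 msig).
exists M => a b ab; rewrite -(wlength_itv_bnd g false false ab) -GE.
have ME : M `]a, b]%classic = lebesgue_stieltjes_measure G `]a, b]%classic by [].
rewrite ME /lebesgue_stieltjes_measure /measure_extension/=.
by rewrite measurable_mu_extE//; exists (a, b).
Qed.

End stieltjes.

Lemma norm_cvg_unique {R : realType} {V : normedModType R} {T : Type}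
    {F : set_system T} {FF : ProperFilter F} {f : T -> V} {l l' : V} :
  f @ F --> l -> f @ F --> l' -> l = l'.
Proof. by move=> fl fl'; exact: (cvg_unique (@norm_hausdorff _ V) fl fl'). Qed.

Section vector_measure_theory.
Context {R : realType} {H : normedModType R}.
Variables (D : set R) (mu : set R -> H).
Hypotheses (mD : measurable D) (mu_vm : vector_measure D mu).
Implicit Types A B : set R.

(** The sums of a constant sequence of empty sets converge, so that their terms
    vanish. *)
Lemma vector_measure0 : mu set0 = 0.
Proof.
have cvg0 : (fun n => \sum_(0 <= i < n) mu set0) @ \oo --> mu set0.
  have := @mu_vm (fun=> set0) (fun=> measurable0) (fun _ _ => False_ind _).
  by rewrite bigcup0//; apply; apply/trivIsetP => i j _ _ _; rewrite set0I.
move: (cvg0); rewrite -cvg_shiftS /= => cvgS.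
have E : (fun n => \sum_(0 <= i < n.+1) mu set0) =
    (fun n => \sum_(0 <= i < n) mu set0) \+ cst (mu set0).
  by apply/funext => n; rewrite big_nat_recr.
rewrite E in cvgS; have muD : mu set0 = mu set0 + mu set0.
  by apply: (norm_cvg_unique cvgS); apply: cvgD cvg0 _; exact: cvg_cst.
by apply: (addrI (mu set0)); rewrite -muD addr0.
Qed.

Lemma vector_measureU A B : measurable A -> measurable B ->
  A `<=` D -> B `<=` D -> A `&` B = set0 -> mu (A `|` B) = mu A + mu B.
Proof.
move=> mA mB AD BD AB.
have := @mu_vm (bigcup2 A B); rewrite bigcup2E => muAB.
have /(_ _ _ _)/wrap[| | |] := muAB.
- by move=> [|[|i]] //=.
- by move=> [|[|i]] //=.
- by rewrite -trivIset_bigcup2.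
rewrite -(cvg_shiftn 2)/=.
have -> : (fun n => \sum_(0 <= i < n + 2) mu (bigcup2 A B i)) =
    cst (mu A + mu B).
  apply/funext => n; rewrite addn2 big_nat_recl// big_nat_recl//= big1 ?addr0//.
  by move=> i _; exact: vector_measure0.
by move=> /norm_cvg_unique/(_ (cvg_cst _)).
Qed.

Lemma vector_measureID A B : measurable A -> measurable B -> A `<=` D ->
  mu A = mu (A `&` B) + mu (A `\` B).
Proof.
move=> mA mB AD; rewrite -vector_measureU ?setUIDK//.
- exact: measurableI.
- exact: measurableD.
- by move=> x [/AD].
- by move=> x [/AD].
- by rewrite setDE setIACA setICr setI0.
Qed.

End vector_measure_theory.

Lemma comp_clamp_continuous {R : realType} {H : normedModType R} (T : R)
    (f : R -> H) : 0 <= T -> {within `[0, T], continuous f} ->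
  continuous (f \o clamp T).
Proof.
move=> T0 fc t; apply/cvgrPdist_le => e e0.
have tD : `[0, T]%classic (clamp T t) by rewrite /= in_itv/= clamp_ge0 clamp_le.
have /subspace_continuousP/(_ _ tD)/cvgrPdist_le/(_ _ e0) := fc.
rewrite near_withinE => /nbhs_ballP[d /= d0 dP].
apply/nbhs_ballP; exists d => // s /= ts; apply: dP; last first.
  by rewrite /= in_itv/= clamp_ge0 clamp_le.
rewrite /ball/= in ts *; apply: le_lt_trans ts.
rewrite ler_norml; have := ler_norm (t - s); have := ler_norm (- (t - s)).
rewrite normrN.
by have [[? ->]|[[? ?] ->]|[? ->]] := clampP t T0;
  have [[? ->]|[[? ?] ->]|[? ->]] := clampP s T0; lra.
Qed.

Section differential_measure_theory.
Context {R : realType} {H : normedModType R} (dot : {dot H for idfun}).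
Hypothesis dot_norm : forall x : H, dot x x = `|x| ^+ 2.

Lemma dot_cvg {U : Type} (F : set_system U) {FF : Filter F} (f : U -> H) l v :
  f @ F --> l -> (fun x => dot v (f x)) @ F --> dot v l.
Proof.
move=> /cvgrPdist_le fl; apply/cvgrPdist_le => e e0.
have v0 : 0 < `|v| + 1 by rewrite ltr_wpDl.
have := fl (e / (`|v| + 1)) (divr_gt0 e0 v0); apply: filterS => x.
rewrite ler_pdivlMr// -dotBr => lf.
apply: le_trans (normr_dot_le dot_norm _ _) _; apply: le_trans lf.
by rewrite mulrC ler_wpM2l// lerDl.
Qed.

Variables (T : R) (y : R -> H) (mu : set R -> H).
Hypotheses (T_gt0 : 0 < T) (y_BV : BV T y).
Hypothesis (y_cont : {within `[0, T], continuous y}).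
Hypothesis (mu_y : differential_measure T y mu).

Let T_ge0 : 0 <= T := ltW T_gt0.
Let D : set R := `[0, T]%classic.
Let J : set R := `]0, T]%classic.
Let mJ : measurable J. Proof. exact: measurable_itv. Qed.
Let mD : measurable D. Proof. exact: measurable_itv. Qed.
Let JD : J `<=` D.
Proof. by move=> x; rewrite /J /D /= !in_itv/= => /andP[/ltW-> ->]. Qed.
Let mu_vm : vector_measure D mu. Proof. by case: mu_y. Qed.

Let mu_point a : 0 <= a -> a <= T -> mu [set a] = 0.
Proof.
move=> a0 aT; have [_ _ /(_ a a a0 (lexx _) aT)] := mu_y.
by rewrite subrr set_itv1.
Qed.

Lemma differential_measure_itv_oc a b : 0 <= a -> a <= b -> b <= T ->
  mu `]a, b]%classic = y b - y a.
Proof.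
move=> a0 ab bT; have [_ _ /(_ a b a0 ab bT) <-] := mu_y.
rewrite (@vector_measureID _ _ D mu mu_vm `[a, b]%classic [set a]).
- rewrite setIidr; last first.
    by move=> _ ->; rewrite /= in_itv/= lexx.
  rewrite mu_point ?(le_trans ab)// add0r; congr mu.
  apply/seteqP; split => x /=; rewrite !in_itv/=.
    by move=> /andP[ax ->]; rewrite (ltW ax); split => // xa; rewrite xa ltxx in ax.
  by move=> [/andP[ax ->] /eqP xa]; rewrite lt_neqAle eq_sym xa ax.
- exact: measurable_itv.
- exact: measurable_set1.
- move=> x; rewrite /D /= !in_itv/= => /andP[ax xb].
  by rewrite (le_trans a0 ax) (le_trans xb bT).
Qed.

Let itv_ocI a b : `]a, b]%classic `&` J = `]clamp T a, clamp T b]%classic.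
Proof.
have T0 : 0 < T := T_gt0.
have [[? ->]|[[? ?] ->]|[? ->]] := clampP a T_ge0;
  have [[? ->]|[[? ?] ->]|[? ->]] := clampP b T_ge0;
  (apply/seteqP; split => x; rewrite /J /= !in_itv/=;
    [move=> [/andP[? ?] /andP[? ?]]; apply/andP|
     move=> /andP[? ?]; split; apply/andP]); split; lra.
Qed.

Let clamp_bounds a b : a <= b -> [/\ 0 <= clamp T a, clamp T a <= clamp T b & clamp T b <= T].
Proof. by move=> ab; rewrite clamp_ge0 clamp_homo// clamp_le. Qed.

Let stieltjes (g : R -> R) (m : {measure set R -> \bar R}) :=
  forall a b, a <= b -> m `]a, b]%classic = (g b - g a)%:E.

Let fin_stieltjes g m F : stieltjes g m -> measurable F ->
  m (F `&` J) \is a fin_num.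
Proof.
move=> mg mF; rewrite ge0_fin_numE//; apply: (@le_lt_trans _ _ (m J)).
  by apply: le_measure; rewrite ?inE//; exact: measurableI.
by rewrite /J mg// ltry.
Qed.

(** A signed difference of two Stieltjes measures that agrees with the scalar
    measure [dot v \o mu] on half-open intervals agrees with it on all Borel
    sets, by Dynkin's lemma. *)
Let dot_differential_measure (k g : R -> R) (mk mg : {measure set R -> \bar R}) v :
  stieltjes k mk -> stieltjes g mg ->
  (forall t, 0 <= t -> t <= T -> k t - g t = dot v (y t)) ->
  forall F, measurable F ->
  fine (mk (F `&` J)) - fine (mg (F `&` J)) = dot v (mu (F `&` J)).
Proof.
move=> kmk gmg kg F mF.
have finmk A : measurable A -> mk (A `&` J) \is a fin_num.
  exact: fin_stieltjes kmk.
have finmg A : measurable A -> mg (A `&` J) \is a fin_num.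
  exact: fin_stieltjes gmg.
pose P (A : set R) :=
  fine (mk (A `&` J)) - fine (mg (A `&` J)) = dot v (mu (A `&` J)).
have Pitv a b : 0 <= a -> a <= b -> b <= T ->
   fine (mk `]a, b]%classic) - fine (mg `]a, b]%classic) = dot v (mu `]a, b]%classic).
  move=> a0 ab bT; rewrite kmk// gmg//= differential_measure_itv_oc// dotBr.
  rewrite -(kg a)// -?(kg b)//; first ring.
    exact: le_trans ab.
  exact: le_trans bT.
have Psub A : measurable A -> mu J = mu (J `&` A) + mu (J `\` A).
  by move=> mA; apply: (vector_measureID mu_vm).
have PJ : P setT by rewrite /P setTI; apply: Pitv.
apply: (@dynkin_induction _ R (@ocitv R) P) => //.
- exact: ocitvI.
- move=> _ [[a b] _ <-] /=; rewrite /P itv_ocI.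
  have [ab|ba] := leP a b.
    by have [? ? ?] := clamp_bounds ab; apply: Pitv.
  rewrite set_itv_ge; last by rewrite bnd_simp -leNgt clamp_homo// ltW.
  by rewrite !measure0 (vector_measure0 mu_vm) dot0r/= subrr.
- move=> S mS PS; move: PJ; rewrite /P setTI setIC -setDE.
  rewrite (Psub S mS) dotDr (setIC J S) -PS.
  have split_m (m : {measure set R -> \bar R}) :
      (forall A, measurable A -> m (A `&` J) \is a fin_num) ->
      fine (m J) = fine (m (J `\` S)) + fine (m (S `&` J)).
    move=> finm; rewrite (measureDI m mJ mS) (setIC J S) fineD// ?finm//.
    by rewrite setDE setIC finm//; exact: measurableC.
  by rewrite (split_m mk finmk) (split_m mg finmg); lra.
- move=> S mS tS PS; rewrite /P setI_bigcupl.
  have mSJ n : measurable (S n `&` J) by exact: measurableI.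
  have tSJ : trivIset setT (fun n => S n `&` J) by exact: trivIset_setIr.
  have cvg_m (m : {measure set R -> \bar R}) :
      (forall A, measurable A -> m (A `&` J) \is a fin_num) ->
      (fun n => \sum_(0 <= i < n) fine (m (S i `&` J))) @ \oo -->
      fine (m (\bigcup_i (S i `&` J))).
    move=> finm.
    have sumE n : (\sum_(0 <= i < n) m (S i `&` J))%E =
        (\sum_(0 <= i < n) fine (m (S i `&` J)))%:E.
      by rewrite -sumEFin; apply: eq_bigr => i _; rewrite fineK// finm.
    have mcvg := @measure_sigma_additive _ _ _ m _ mSJ tSJ.
    suff H1 : (fun n => (\sum_(0 <= i < n) fine (m (S i `&` J)))%:E) @ \oo -->
        (fine (m (\bigcup_i (S i `&` J))))%:E by exact: fine_cvg H1.
    rewrite fineK; last by rewrite -setI_bigcupl finm//; exact: bigcup_measurable.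
    by under eq_cvg do rewrite -sumE.
  have dotmu : (fun n => dot v (\sum_(0 <= i < n) mu (S i `&` J))) @ \oo -->
      dot v (mu (\bigcup_i (S i `&` J))).
    by apply: dot_cvg; apply: mu_vm => // n x [_ /JD].
  have dotE : (fun n => dot v (\sum_(0 <= i < n) mu (S i `&` J))) =
      (fun n => \sum_(0 <= i < n) fine (mk (S i `&` J))) \-
      (fun n => \sum_(0 <= i < n) fine (mg (S i `&` J))).
    apply/funext => n; rewrite dot_sumr/= -sumrB.
    by apply: eq_bigr => i _; rewrite PS.
  rewrite dotE in dotmu.
  apply: (@norm_cvg_unique R R^o _ _ _ _ _ _ _ dotmu).
  by apply: cvgB; exact: cvg_m.
Qed.


Lemma chain_sum_le_vm_variation p n : chain 0 T p ->
  ((chain_sum y p n)%:E <= vm_variation D mu D)%E.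
Proof.
move=> pc; apply: ereal_sup_ubound.
exists n, (fun i : 'I_n => `]p i, p i.+1]%classic); split.
- by move=> i; exact: measurable_itv.
- rewrite setIid => i x; rewrite /D /= !in_itv/= => /andP[px xp].
  have [p0 _ _] := pc i; have [_ pT _] := pc i.+1.
  by rewrite (le_trans p0 (ltW px)) (le_trans xp pT).
- apply/trivIsetP => i j _ _ ij; apply/seteqP; split => // x [/=].
  rewrite !in_itv/= => /andP[pix xpi] /andP[pjx xpj].
  have [ltij|ltji|/val_inj eij] := ltngtP i j; last by rewrite eij eqxx in ij.
    have := le_lt_trans (chain_le pc ltij) pjx.
    by rewrite ltNge xpi.
  have := le_lt_trans (chain_le pc ltji) pix.
  by rewrite ltNge xpj.
- congr EFin; apply: eq_bigr => i _.
  have [p0 _ pp] := pc i; have [_ pT _] := pc i.+1.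
  by rewrite differential_measure_itv_oc.
Qed.

Lemma var_le_vm_variation : ((var y T)%:E <= vm_variation D mu D)%E.
Proof.
apply/lee_addgt0Pr => e e0.
have [p [n [pc _ _ pe]]] := partition_near_var T_gt0 y_BV e0.
apply: (@le_trans _ _ (chain_sum y p n + e)%:E).
  by rewrite lee_fin -lerBlDr ltW.
by rewrite EFinD leeD2r// chain_sum_le_vm_variation.
Qed.

Let vm_variationID A : measurable A ->
  (vm_variation D mu D <= vm_variation D mu A + vm_variation D mu (~` A))%E.
Proof.
move=> mA; apply: ub_ereal_sup => _ [n [F [mF FD tF ->]]].
have {}FD i : F i `<=` D by move=> x /FD[].
apply: (@le_trans _ _ ((\sum_(i < n) `|mu (F i `&` A)|)%:E +
                       (\sum_(i < n) `|mu (F i `\` A)|)%:E)%E).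
  rewrite -EFinD lee_fin -big_split/=; apply: ler_sum => i _.
  by rewrite (vector_measureID mu_vm (mF i) mA (FD i)) ler_normD.
apply: leeD; apply: ereal_sup_ubound.
- exists n, (fun i => F i `&` A); split => //.
  + by move=> i; exact: measurableI.
  + by move=> i x [Fx Ax]; split => //; exact: FD Fx.
  + exact: trivIset_setIr.
- exists n, (fun i => F i `\` A); split => //.
  + by move=> i; exact: measurableD.
  + by move=> i x [Fx Ax]; split => //; exact: FD Fx.
  + exact: (@trivIset_setIr _ _ setT F (fun=> ~` A) tF).
Qed.

Variable m : {measure set R -> \bar R}.
Hypothesis m_stieltjes : stieltjes (fun t => var y (clamp T t)) m.

(** For the unit vector [v] in the direction of [mu F], the function
    [var y - dot v y] is nondecreasing; its Stieltjes measure is [m] minus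
    [dot v \o mu], and it is nonnegative at [F]. *)
Lemma norm_differential_measure_le F : measurable F -> F `<=` D ->
  (`|mu F|%:E <= m F)%E.
Proof.
move=> mF FD; have muE : mu F = mu (F `&` J).
  rewrite (vector_measureID mu_vm mF mJ FD).
  suff -> : mu (F `\` J) = 0 by rewrite addr0.
  have FJ0 : F `\` J `<=` [set 0].
    move=> x [/FD]; rewrite /D /J /= !in_itv/= => /andP[x0 ->].
    by rewrite andbT => /negP; rewrite -leNgt => x0'; apply/le_anti/andP.
  by have [->|->] := subset_set1 FJ0; [exact: vector_measure0 mu_vm|exact: mu_point].
apply: (@le_trans _ _ (m (F `&` J))); last first.
  by apply: le_measure; rewrite ?inE//; exact: measurableI.
rewrite muE; have [->|c0] := eqVneq (mu (F `&` J)) 0; first by rewrite normr0.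
set c := mu (F `&` J) in c0 *; pose v := `|c|^-1 *: c.
have nc0 : 0 < `|c| by rewrite normr_gt0.
have v1 : `|v| = 1 by rewrite normrZ normfV normr_id mulVf// gt_eqF.
pose G t := var y (clamp T t).
pose g t := G t - dot v (y (clamp T t)).
have ghomo : {homo g : s t / s <= t}.
  move=> s t st; have [s0 st' tT] := clamp_bounds st.
  have := var_dominates T_gt0 y_BV s0 st' tT.
  have := dot_le_norm dot_norm v (y (clamp T t) - y (clamp T s)).
  by rewrite v1 mul1r dotBr /g /G; lra.
have gcont : continuous g.
  move=> t; apply: cvgB; first exact: var_clamp_continuous.
  apply: dot_cvg; exact: (@comp_clamp_continuous _ _ T y T_ge0 y_cont t).
have [mg mgP] := stieltjes_measure_exists ghomo gcont.
have dotE t : 0 <= t -> t <= T -> G t - g t = dot v (y t).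
  by move=> t0 tT; rewrite /g subKr clamp_id.
have := dot_differential_measure m_stieltjes mgP dotE mF.
rewrite -/c /v dotZl dot_norm expr2 mulKf ?gt_eqF// => normc.
rewrite -normc -(fineK (fin_stieltjes m_stieltjes mF)) lee_fin.
by rewrite gerBl fine_ge0.
Qed.

(** The left-hand side is at most [m] by [norm_differential_measure_le]. It is
    also subadditive, and on [[0, T]] it is at least [var y T], which is the total
    mass of [m]; hence nothing can be lost on [A] or on its complement. *)
Lemma vm_variationE A : measurable A -> vm_variation D mu A = m (A `&` D).
Proof.
move=> mA.
have le_m B : measurable B -> (vm_variation D mu B <= m (B `&` D))%E.
  move=> mB; apply: ub_ereal_sup => _ [n [F [mF FBD tF ->]]].
  apply: (@le_trans _ _ (\sum_(i < n) m (F i))%E).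
    rewrite -sumEFin; apply: lee_sum => i _.
    by apply: norm_differential_measure_le => // x /FBD[].
  rewrite -measure_bigsetU_ord//; apply: le_measure; rewrite ?inE.
  - exact: bigsetU_measurable.
  - exact: measurableI.
  - by elim/big_ind: _ => [x []|X Y XAD YAD x [/XAD|/YAD]|i _].
have mDle : (m D <= (var y T)%:E)%E.
  apply: (@le_trans _ _ (m `]-1, T]%classic)).
    apply: le_measure; rewrite ?inE//.
    move=> x; rewrite /D /= !in_itv/= => /andP[x0 ->].
    by rewrite andbT (lt_le_trans _ x0)// ltrN10.
  have N1T : -1 <= T by apply: le_trans T_ge0; rewrite lerN10.
  rewrite m_stieltjes// (clampT T_ge0 (lexx T)) clamp0 ?lerN10//.
  by rewrite (var0 T_gt0 y_BV) subr0.
have mDE : m D = (m (A `&` D) + m (~` A `&` D))%E.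
  by rewrite (measureDI m mD mA) addeC setIC setDE [D `&` ~` A]setIC.
have mDfin : m D \is a fin_num.
  by rewrite ge0_fin_numE//; apply: le_lt_trans mDle _; rewrite ltry.
have mCA : measurable (~` A) by exact: measurableC.
have := le_trans mDle (le_trans var_le_vm_variation (vm_variationID mA)).
have := le_m _ mA; have := le_m _ mCA; move: mDfin; rewrite mDE => mDfin.
have vm0 B : (0 <= vm_variation D mu B)%E.
  apply: ereal_sup_ubound; exists 0%N, (fun=> set0).
  by split => [[]//|[]//|[]//|]; rewrite big_ord0.
have := vm0 A; have := vm0 (~` A).
move: mDfin; rewrite fin_numD => /andP[].
case: (m (A `&` D)) => [a| |]//; case: (m (~` A `&` D)) => [b| |]// _ _.
case: (vm_variation D mu A) => [c| |]//; case: (vm_variation D mu (~` A)) => [d| |]//.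
rewrite -!EFinD !lee_fin => _ _ db ca abcd; congr EFin; apply/le_anti.
by rewrite ca/=; lra.
Qed.

Lemma integral_vm_variation f :
  (\int[vm_variation D mu]_(t in D) f t = \int[m]_(t in D) f t)%E.
Proof.
have vm0 : vm_variation D mu set0 = 0%E by rewrite vm_variationE// set0I measure0.
have vm_ge0 A : (0 <= vm_variation D mu A)%E.
  apply: ereal_sup_ubound; exists 0%N, (fun=> set0).
  by split => [[]//|[]//|[]//|]; rewrite big_ord0.
have vm_sigma : semi_sigma_additive (vm_variation D mu).
  move=> F mF tF mUF; rewrite vm_variationE//.
  under eq_cvg do under eq_bigr do rewrite vm_variationE//.
  exact: (@measure_semi_sigma_additive _ _ _ (mrestr m mD) F mF tF mUF).
pose M : {measure set R -> \bar R} :=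
  HB.pack (vm_variation D mu) (isMeasure.Build _ _ _ _ vm0 vm_ge0 vm_sigma).
apply: (@eq_measure_integral _ _ _ D m M) => A mA AD.
by rewrite /= vm_variationE//; congr (m _); exact: setIidl.
Qed.

End differential_measure_theory.

(** * The integral of a vector function against a vector measure *)

Section step_integrals.
Context {R : realType} {H : normedModType R} (dot : {dot H for idfun}).
Hypothesis dot_norm : forall x : H, dot x x = `|x| ^+ 2.
Variables (D : set R) (mu : set R -> H) (m : {measure set R -> \bar R}).
Hypotheses (mD : measurable D) (mu_vm : vector_measure D mu).
Hypothesis mu_le_m : forall F, measurable F -> F `<=` D -> (`|mu F|%:E <= m F)%E.
Hypothesis m_fin : (m D < +oo)%E.

(** [H] is arbitrary, so that measurability is only available for real functions
    of a step map. The dependence of [f] on [t] lets the induction absorb the first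
    step into [f]. *)
Lemma measurable_step n (A : 'I_n -> set R) (v : 'I_n -> H) (f : R -> H -> R) :
  (forall j, measurable (A j)) ->
  (forall h, measurable_fun setT (f ^~ h)) ->
  measurable_fun setT (fun t => f t (\sum_(j < n) \1_(A j) t *: v j)).
Proof.
elim: n A v f => [|n IH] A v f mA mf; first by under eq_fun do rewrite big_ord0; exact: mf.
under eq_fun do rewrite big_ord_recl.
apply: (IH (fun j => A (lift ord0 j)) (fun j => v (lift ord0 j))
  (fun t h => f t (\1_(A ord0) t *: v ord0 + h))) => // h.
have -> : (fun t => f t (\1_(A ord0) t *: v ord0 + h)) =
   (fun t => \1_(A ord0) t * f t (v ord0 + h) + (1 - \1_(A ord0) t) * f t h).
  apply/funext => t; rewrite indicE; case: (t \in A ord0).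
    by rewrite scale1r mul1r subrr mul0r addr0.
  by rewrite scale0r add0r mul0r add0r subr0 mul1r.
apply: measurable_funD; apply: measurable_funM => //.
by apply: measurable_funB.
Qed.

Let measurable_norm_step n (A : 'I_n -> set R) (v : 'I_n -> H) c B :
  (forall j, measurable (A j)) ->
  measurable_fun B (fun t => `|c + \sum_(j < n) \1_(A j) t *: v j|%:E).
Proof.
move=> mA; apply/measurable_EFinP; apply: measurable_funTS.
exact: (@measurable_step _ A v (fun _ h => `|c + h|)).
Qed.

(** The sets of a step map may overlap. Splitting [B] along the first of them makes
    its value a constant on each part, and [c] collects the constants. *)
Lemma step_sum_le n (A : 'I_n -> set R) (v : 'I_n -> H) :
  (forall j, measurable (A j)) ->
  forall B c, measurable B -> B `<=` D ->
  (`|dot c (mu B) + \sum_(j < n) dot (v j) (mu (A j `&` B))|%:E <=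
   \int[m]_(t in B) `|c + \sum_(j < n) \1_(A j) t *: v j|%:E)%E.
Proof.
elim: n A v => [|n IH] A v mA B c mB BD.
  rewrite big_ord0 addr0; under eq_integral do rewrite big_ord0 addr0.
  rewrite integral_cst//; apply: (@le_trans _ _ (`|c|%:E * `|mu B|%:E)%E).
    by rewrite -EFinM lee_fin (normr_dot_le dot_norm).
  by apply: lee_wpmul2l; rewrite ?lee_fin// mu_le_m.
pose A' j := A (lift ord0 j); pose v' j := v (lift ord0 j).
pose A0 := A ord0.
have mA' j : measurable (A' j) by exact: mA.
have mB1 : measurable (B `&` A0) by apply: measurableI => //; exact: mA.
have mB2 : measurable (B `\` A0) by apply: measurableD => //; exact: mA.
have B1D : B `&` A0 `<=` D by move=> x [/BD].
have B2D : B `\` A0 `<=` D by move=> x [/BD].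
rewrite -{3}(setUIDK B A0) ge0_integral_setU//; last 2 first.
- exact: measurable_norm_step.
- by apply/disj_setPS => x [[_ ?] [_ ?]].
have -> : (\int[m]_(t in B `&` A0) `|c + \sum_(j < n.+1) \1_(A j) t *: v j|%:E =
  \int[m]_(t in B `&` A0) `|(c + v ord0) + \sum_(j < n) \1_(A' j) t *: v' j|%:E)%E.
  apply: eq_integral => t; rewrite inE => -[_ At].
  by rewrite big_ord_recl indicE mem_set// scale1r addrA.
have -> : (\int[m]_(t in B `\` A0) `|c + \sum_(j < n.+1) \1_(A j) t *: v j|%:E =
  \int[m]_(t in B `\` A0) `|c + \sum_(j < n) \1_(A' j) t *: v' j|%:E)%E.
  apply: eq_integral => t; rewrite inE => -[_ At].
  by rewrite big_ord_recl indicE memNset// scale0r add0r.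
apply: le_trans (leeD (IH A' v' mA' _ (c + v ord0) mB1 B1D)
                      (IH A' v' mA' _ c mB2 B2D)).
rewrite -EFinD lee_fin; apply: le_trans (ler_normD _ _).
rewrite le_eqVlt; apply/orP; left; apply/eqP; congr `|_|.
rewrite big_ord_recl (setIC (A ord0)) -/A0.
rewrite (vector_measureID mu_vm mB (mA ord0) BD) dotDl dotDr -/A0.
have -> : \sum_(j < n) dot (v (lift ord0 j)) (mu (A (lift ord0 j) `&` B)) =
   \sum_(j < n) dot (v' j) (mu (A' j `&` (B `&` A0))) +
   \sum_(j < n) dot (v' j) (mu (A' j `&` (B `\` A0))).
  rewrite -big_split/=; apply: eq_bigr => j _.
  rewrite (vector_measureID mu_vm (_ : measurable (A' j `&` B)) (mA ord0)).
  - by rewrite dotDr -/A0 setIA setIDA.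
  - exact: measurableI.
  - by move=> x [_ /BD].
ring.
Qed.

Lemma step_integral_sub_le (s s' : step_map D) :
  (`|step_integral dot mu s - step_integral dot mu s'|%:E <=
   \int[m]_(t in D) `|step_fun s t - step_fun s' t|%:E)%E.
Proof.
pose A (j : 'I_(step_size s + step_size s')) :=
  match fintype.split j with inl i => step_set i | inr i => step_set i end.
pose v (j : 'I_(step_size s + step_size s')) :=
  match fintype.split j with inl i => step_val i | inr i => - step_val i end.
have Al i : A (lshift _ i) = step_set i by rewrite /A (unsplitK (inl i)).
have Ar i : A (rshift _ i) = step_set i by rewrite /A (unsplitK (inr i)).
have vl i : v (lshift _ i) = step_val i by rewrite /v (unsplitK (inl i)).
have vr i : v (rshift _ i) = - step_val i by rewrite /v (unsplitK (inr i)).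
have mA j : measurable (A j).
  by rewrite /A; case: (fintype.split j) => i; exact: step_set_measurable.
have AD j : A j `<=` D.
  by rewrite /A; case: (fintype.split j) => i; exact: step_set_sub.
have integralE : \sum_j dot (v j) (mu (A j `&` D)) =
    step_integral dot mu s - step_integral dot mu s'.
  rewrite big_split_ord/= -sumrN; congr (_ + _); apply: eq_bigr => i _.
    by rewrite Al vl setIidl//; exact: step_set_sub.
  by rewrite Ar vr dotNl setIidl//; exact: step_set_sub.
have funE t : 0 + \sum_j \1_(A j) t *: v j = step_fun s t - step_fun s' t.
  rewrite add0r big_split_ord/= -sumrN; congr (_ + _); apply: eq_bigr => i _.
    by rewrite Al vl.
  by rewrite Ar vr scalerN.
have := step_sum_le v mA 0 mD (fun _ => id).
by rewrite dot0l add0r integralE; under eq_integral do rewrite funE.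
Qed.

Hypothesis vm_m : forall f : R -> \bar R,
  (\int[vm_variation D mu]_(t in D) f t = \int[m]_(t in D) f t)%E.

Section approximable.
Variable w : R -> H.
Hypothesis w_meas : forall h, measurable_fun D (fun t => `|w t - h|).
Hypothesis w_approx : forall e : R, 0 < e ->
  exists s : step_map D, forall t, D t -> `|w t - step_fun s t| <= e.

Lemma measurable_sub_step (s : step_map D) :
  measurable_fun D (fun t => `|w t - step_fun s t|%:E).
Proof.
apply/measurable_EFinP.
have ms : measurable_fun setT (fun t => \1_D t * `|w t - step_fun s t|).
  apply: (@measurable_step _ (@step_set _ _ _ s) (@step_val _ _ _ s)
    (fun t h => \1_D t * `|w t - h|) (@step_set_measurable _ _ _ s)) => h.
  have -> : (fun t => \1_D t * `|w t - h|) = (fun t => `|w t - h|) \_ D.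
    apply/funext => t; rewrite indicE /patch; case: (t \in D); rewrite ?mul1r//.
    by rewrite mul0r.
  exact: (measurable_restrictT _ _).1.
apply: (eq_measurable_fun (fun t => \1_D t * `|w t - step_fun s t|)).
  by move=> t tD; rewrite indicE tD mul1r.
exact: measurable_funTS.
Qed.

Let step_triangle (s s' : step_map D) :
  (\int[m]_(t in D) `|step_fun s t - step_fun s' t|%:E <=
   \int[m]_(t in D) `|w t - step_fun s t|%:E +
   \int[m]_(t in D) `|w t - step_fun s' t|%:E)%E.
Proof.
rewrite -ge0_integralD//; try exact: measurable_sub_step.
apply: ge0_le_integral => //.
- apply/measurable_EFinP; apply: measurable_funTS.
  apply: (@measurable_step _ (@step_set _ _ _ s) (@step_val _ _ _ s)
    (fun t h => `|h - step_fun s' t|) (@step_set_measurable _ _ _ s)) => h.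
  exact: (@measurable_step _ (@step_set _ _ _ s') (@step_val _ _ _ s')
    (fun t h' => `|h - h'|) (@step_set_measurable _ _ _ s')).
- by apply: emeasurable_funD; exact: measurable_sub_step.
- move=> t _; rewrite -EFinD lee_fin [X in _ <= X + _]distrC.
  exact: ler_distD.
Qed.

Let approx_integral_le e (s : step_map D) :
  (forall t, D t -> `|w t - step_fun s t| <= e) ->
  (\int[m]_(t in D) `|w t - step_fun s t|%:E <= e%:E * m D)%E.
Proof.
move=> se; rewrite -integral_cst//; apply: ge0_le_integral => //.
exact: measurable_sub_step.
Qed.

(** The integral is defined by an arbitrary choice among limits of integrals of
    step maps: such a limit exists because the integrals of a uniformly
    approximating sequence are Cauchy, and the bound holds for every limit. *)
Lemma dot_integral_sub_step_le (s0 : step_map D) :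
  (`|dot_integral dot D mu w - step_integral dot mu s0|%:E <=
   \int[m]_(t in D) `|w t - step_fun s0 t|%:E)%E.
Proof.
rewrite /dot_integral; set S := (X in xget 0 X).
have vm_stepE (s : nat -> step_map D) :
    (fun n => \int[vm_variation D mu]_(t in D) `|w t - step_fun (s n) t|%:E)%E =
    (fun n => \int[m]_(t in D) `|w t - step_fun (s n) t|%:E)%E.
  by apply/funext => n; exact: vm_m.
have Mfin : m D = (fine (m D))%:E by rewrite fineK// ge0_fin_numE.
set M := fine (m D) in Mfin; have M0 : 0 <= M by rewrite fine_ge0.
have [I [s [sw sI]]] : S !=set0.
  have approx n : exists s : step_map D,
      forall t, D t -> `|w t - step_fun s t| <= n.+1%:R^-1.
    by apply: w_approx; rewrite invr_gt0.
  have [s sP] := choice approx.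
  have int_s n : (\int[m]_(t in D) `|w t - step_fun (s n) t|%:E <=
      (n.+1%:R^-1 * M)%:E)%E.
    by rewrite EFinM -Mfin; apply: approx_integral_le; exact: sP.
  have cvg_inv : (fun n => n.+1%:R^-1 * M) @ \oo --> (0 : R).
    by rewrite -(mul0r M); apply: cvgMl; exact: cvg_harmonic.
  have s_cauchy : cauchy ((fun n => step_integral dot mu (s n)) @ \oo).
    apply: cauchy_exP => e e0; have e2 : 0 < e / 2 by rewrite divr_gt0.
    have /cvgrPdist_lt/(_ _ e2)[N _ NP] := cvg_inv.
    have {}NP n : (N <= n)%N -> n.+1%:R^-1 * M < e / 2.
      by move=> /NP /=; rewrite sub0r normrN; apply: le_lt_trans; exact: ler_norm.
    exists (step_integral dot mu (s N)), N => // n /= Nn.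
    rewrite /ball/= -lte_fin; apply: le_lt_trans (step_integral_sub_le _ _) _.
    apply: le_lt_trans (step_triangle _ _) _.
    apply: le_lt_trans (leeD (int_s _) (int_s _)) _.
    by rewrite -EFinD lte_fin [X in _ < X](splitr e) ltrD ?NP.
  have /cauchy_cvgP s_cvg := s_cauchy.
  exists (lim ((fun n => step_integral dot mu (s n)) @ \oo)), s; split => //.
  rewrite vm_stepE.
  apply: (squeeze_cvge (f := cst 0%E) (h := fun n => (n.+1%:R^-1 * M)%:E)).
  - by apply: nearW => n; rewrite int_s andbT integral_ge0.
  - exact: cvg_cst.
  - by apply: cvg_EFin cvg_inv; exact: nearW.
have [{sw sI}s [sw sI]] : S (xget 0 S) by apply: xgetPex; exists I, s.
set I' := xget 0 S in sI *.
apply/lee_addgt0Pr => e e0; have e2 : 0 < e / 2 by rewrite divr_gt0.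
have /cvgrPdist_lt/(_ _ e2)[N1 _ N1P] := sI.
have [N2 _ N2P] : \forall n \near \oo,
    (\int[m]_(t in D) `|w t - step_fun (s n) t|%:E <= (e / 2)%:E)%E.
  move: sw; rewrite vm_stepE.
  move=> /fine_cvgP[fin_s] /cvgrPdist_lt/(_ _ e2); apply: filterS2 fin_s => n fin_n.
  rewrite sub0r normrN => se; rewrite -(fineK fin_n) lee_fin.
  exact: le_trans (ler_norm _) (ltW se).
pose n := maxn N1 N2.
have In := N1P n (leq_maxl _ _); have sn := N2P n (leq_maxr _ _).
apply: (@le_trans _ _ ((e / 2)%:E +
    `|step_integral dot mu (s n) - step_integral dot mu s0|%:E)%E).
  rewrite -EFinD lee_fin; apply: le_trans (ler_distD (step_integral dot mu (s n)) _ _) _.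
  by rewrite lerD2r ltW.
apply: (@le_trans _ _ ((e / 2)%:E + ((e / 2)%:E +
    \int[m]_(t in D) `|w t - step_fun s0 t|%:E))%E).
  apply: leeD => //; apply: le_trans (step_integral_sub_le _ _) _.
  by apply: le_trans (step_triangle _ _) _; apply: leeD.
by rewrite addeA -EFinD -splitr addeC.
Qed.

End approximable.
End step_integrals.

(** * The localized variational inequality *)

Lemma subBB {V : zmodType} (p a b : V) : (p - a) - (p - b) = b - a.
Proof. by rewrite opprB [LHS]addrC addrA subrK. Qed.

Lemma subACB {V : zmodType} (a b c d : V) :
  (a - b) - (c - d) = (a - c) - (b - d).
Proof. by rewrite !opprD addrACA. Qed.

Section local_inequality.
Context {R : realType} {H : normedModType R} (dot : {dot H for idfun}).
Hypothesis dot_norm : forall x : H, dot x x = `|x| ^+ 2.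

Definition in_oc (a b t : R) : bool := (a < t) && (t <= b).

(** The step map takes the values of [f] at the left ends of intervals on which
    [G] increases by at most [e]. *)
Lemma step_approximation (T a b : R) (f : R -> H) (G : R -> R) (e : R) :
  0 <= a -> a <= b -> b <= T -> 0 < e ->
  continuous G -> (forall s t, s < t -> G s < G t) -> dominates a b f G ->
  exists s : step_map `[0, T]%classic, forall t,
    `|(if in_oc a b t then f t else 0) - step_fun s t| <= e.
Proof.
move=> a0 ab bT e0 Gc Ginc fG.
have [tau [tau0 tau1 Gtau tauP]] := equal_division ab Gc Ginc.
have [N N0 NP] : exists2 N, (0 < N)%N & (G b - G a) / e <= N%:R.
  exists (Num.truncn ((G b - G a) / e)).+1 => //; exact/ltW/truncnS_gt.
have NR : 0 < N%:R :> R by rewrite ltr0n.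
pose p i := tau (i%:R / N%:R).
have step01 i : (i < N)%N -> [/\ 0 <= i%:R / N%:R :> R,
    i%:R / N%:R <= i.+1%:R / N%:R :> R & i.+1%:R / N%:R <= 1 :> R].
  move=> iN; rewrite divr_ge0// ler_pM2r ?invr_gt0// ler_nat leqnSn.
  by rewrite ler_pdivrMr// mul1r ler_nat.
have pP i : (i < N)%N -> [/\ a <= p i, p i <= p i.+1 & p i.+1 <= b].
  by move=> /step01[? ? ?]; exact: tauP.
have Gp i : (i < N)%N -> G (p i.+1) - G (p i) <= e.
  move=> /[dup] iN /step01[i0 ii i1].
  rewrite Gtau ?(le_trans i0)// Gtau ?(le_trans ii)//.
  rewrite opprD addrACA subrr add0r -mulrBl -mulrBl -natr1 addrC addKr mul1r.
  by rewrite mulrC ler_pdivrMr// mulrC -ler_pdivrMr.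
have mset (j : 'I_N) : measurable `]p j, p j.+1]%classic by exact: measurable_itv.
have sub (j : 'I_N) : `]p j, p j.+1]%classic `<=` `[0, T]%classic.
  have [? ? ?] := pP j (ltn_ord j).
  move=> x; rewrite /= !in_itv/= => /andP[px xp].
  by rewrite (le_trans a0)/= ?(le_trans _ bT) ?(le_trans xp)// (le_trans _ (ltW px)).
exists (StepMap (fun j : 'I_N => f (p j)) mset sub) => t.
rewrite /step_fun/=.
pose S k := \sum_(j < k) \1_(`]p j, p j.+1]%classic) t *: f (p j).
have p0 : p 0%N = a by rewrite /p mul0r.
have pN : p N = b by rewrite /p divff ?tau1// gt_eqF.
have Sk k : (k <= N)%N -> if t <= a then S k == 0 else
    if t <= p k then `|f t - S k| <= e else S k == 0.
  elim: k => [_|k IH kN].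
    by rewrite p0 /S big_ord0; case: leP.
  have := IH (ltnW kN); have [ak kk kb] := pP k kN.
  have -> : S k.+1 = S k + ((p k < t) && (t <= p k.+1))%:R *: f (p k).
    rewrite /S big_ord_recr/= indicE; congr (_ + (_%:R *: _)); congr nat_of_bool.
    by apply/idP/idP; rewrite inE /= in_itv.
  have [ta /eqP->|at_] := leP t a.
    by rewrite ltNge (le_trans ta ak)/= scale0r addr0.
  have [tk|kt /eqP->] := leP t (p k).
    by rewrite /= (le_trans tk kk) scale0r addr0.
  have [tk|_] := leP t (p k.+1); last by rewrite scale0r addr0.
  rewrite scale1r add0r; apply: le_trans (Gp k kN).
  apply: le_trans (fG _ _ ak (ltW kt) (le_trans tk kb)) _.
  by rewrite lerD2r; move: tk; rewrite le_eqVlt => /orP[/eqP->//|/Ginc/ltW].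
have := Sk N (leqnn N); rewrite pN -/(S N) /in_oc ltNge.
case: (leP t a) => [_ /eqP->|_] /=; first by rewrite subrr normr0 ltW.
by case: (leP t b) => // _ /eqP->; rewrite subrr normr0 ltW.
Qed.

Lemma BV_replace (T a b : R) (x : R -> H) (p : H) : 0 < T -> BV T x ->
  BV T (fun t => if in_oc a b t then p else x t).
Proof.
move=> T0 xBV.
pose K := `|p - x 0| + var x T.
have pK t : 0 <= t -> t <= T -> `|p - x t| <= K.
  move=> t0 tT; apply: le_trans (ler_distD (x 0) _ _) _.
  rewrite lerD2l distrC; apply: le_trans (var_dominates T0 xBV (lexx 0) t0 tT) _.
  by rewrite (var0 T0 xBV) subr0; exact: (var_homo T0 xBV t0 tT (lexx T)).
have K0 : 0 <= K by apply: le_trans (pK 0 _ _) => //; exact: ltW.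
pose G t := var x t + K * ((a < t)%R%:R + (b < t)%R%:R).
apply: (@BV_dominated R H T _ G (ltW T0)).
rewrite /G => s t s0 st tT; have sT := le_trans st tT; have t0 := le_trans s0 st.
have xst := var_dominates T0 xBV s0 st tT.
have vst := le_trans (normr_ge0 _) xst.
have := pK _ s0 sT; have := pK _ t0 tT; rewrite /in_oc [`|p - x t|]distrC.
case: (ltP a s) => as_; case: (ltP a t) => at_;
 case: (leP s b) => sb; case: (leP t b) => tb //=; rewrite ?subrr ?normr0; lra.
Qed.

(** The variational inequality is tested with [p] on [(a, b]] and with [x = u - y]
    elsewhere, so that only [(a, b]] contributes. There [x] is replaced by its value
    at [c], at the cost of [d]. *)
Lemma play_local (T r : R) (Z : set H) (u : R -> H) (z0 : H) (y : R -> H) :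
  0 < T -> 0 < r -> CBV T u -> is_play dot T r Z u z0 y ->
  forall p a b c M d, Z p -> 0 <= a -> a <= b -> b <= T -> a <= c -> c <= b ->
  (forall t, a <= t -> t <= b -> `|p - (u t - y t)| <= M) ->
  (forall t, a <= t -> t <= b -> `|(u t - y t) - (u c - y c)| <= d) ->
  dot (p - (u c - y c)) (y b - y a) <=
  (M ^+ 2 / (2 * r) + d) * (var y b - var y a).
Proof.
move=> T0 r0 [uc uBV] [[yc yBV] Zuy uy0 [mu mu_y VI]] p a b c M d Zp a0 ab bT ac cb
  pM xd.
pose x t := u t - y t.
pose D : set R := `[0, T]%classic.
have T_ge0 := ltW T0.
have mD : measurable D by exact: measurable_itv.
pose W t := if in_oc a b t then p - x t else 0.
pose z t := if in_oc a b t then p else x t.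
have xBV : BV T x.
  apply: (@BV_dominated R H T x (fun t => var u t + var y t) T_ge0) => s t s0 st tT.
  have -> : x t - x s = (u t - u s) - (y t - y s).
    by rewrite /x subACB.
  apply: le_trans (ler_normB _ _) _; rewrite opprD addrACA.
  by apply: lerD; [exact: (var_dominates T0 uBV)|exact: (var_dominates T0 yBV)].
have zBV : BV T z by exact: BV_replace.
have zZ t : t \in `[0, T] -> Z (z t) by rewrite /z; case: ifP => // _ /Zuy.
have wE : (fun t => z t - u t + y t) = W.
  apply/funext => t; rewrite /z /W /x; case: ifP => _.
    by rewrite opprB addrA addrAC.
  by rewrite (addrAC (u t)) subrr add0r addNr.
have wEt t : z t - u t + y t = W t by rewrite -wE.
have := VI z zBV zZ; rewrite /= wE {VI}.
have [m mP] := stieltjes_measure_exists (var_clamp_homo T0 yBV)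
  (var_clamp_continuous T0 yBV yc).
have mu_vm : vector_measure D mu by case: mu_y.
have mu_le := norm_differential_measure_le dot_norm T0 yBV yc mu_y mP.
have vm_m f := integral_vm_variation dot_norm T0 yBV yc mu_y mP f.
have mab : m `]a, b]%classic = (var y b - var y a)%:E.
  by rewrite mP// !clamp_id// ?(le_trans a0)// (le_trans ab).
have mDfin : (m D < +oo)%E.
  apply: (@le_lt_trans _ _ (m `]-1, T]%classic)).
    apply: le_measure; rewrite ?inE//.
    move=> t; rewrite /D /= !in_itv/= => /andP[t0 ->].
    by rewrite andbT (lt_le_trans _ t0)// ltrN10.
  by rewrite mP ?ltry// (le_trans _ T_ge0)// lerN10.
have abD : `]a, b]%classic `<=` D.
  move=> t; rewrite /D /= !in_itv/= => /andP[at_ tb].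
  by rewrite (le_trans a0 (ltW at_)) (le_trans tb bT).
have indE t : \1_(`]a, b]%classic : set R) t = (in_oc a b t)%:R :> R.
  by rewrite indicE; congr (_%:R); congr nat_of_bool; apply/idP/idP; rewrite inE /= in_itv.
have W_meas h : measurable_fun D (fun t => `|W t - h|).
  pose g t := \1_(`]a, b]%classic : set R) t * `|p - (x \o clamp T) t - h| +
    (1 - \1_(`]a, b]%classic : set R) t) * `|h|.
  apply: (eq_measurable_fun g).
    move=> t; rewrite inE /D /= in_itv/= => /andP[t0 tT].
    rewrite /g indE /W /= clamp_id//; case: (in_oc a b t).
      by rewrite mul1r subrr mul0r addr0.
    by rewrite mul0r add0r subr0 mul1r sub0r normrN.
  apply: measurable_funTS.
  have xcc : continuous (x \o clamp T).
    have ucc := comp_clamp_continuous T_ge0 uc.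
    have ycc := comp_clamp_continuous T_ge0 yc.
    by move=> t; apply: cvgB; [exact: ucc|exact: ycc].
  apply: measurable_funD; apply: measurable_funM => //.
    apply: continuous_measurable_fun => t; apply: cvg_norm; apply: cvgB.
      by apply: cvgB; [exact: cvg_cst|exact: xcc].
    exact: cvg_cst.
  by apply: measurable_funB.
have W_approx e : 0 < e ->
    exists s : step_map D, forall t, D t -> `|W t - step_fun s t| <= e.
  move=> e0.
  pose G t := var u (clamp T t) + var y (clamp T t) + t.
  have Gc : continuous G.
    move=> t; apply: cvgD; last exact: cvg_id.
    by apply: cvgD; apply: var_clamp_continuous.
  have Ginc s t : s < t -> G s < G t.
    move=> st; apply: ler_ltD => //; apply: lerD; apply: var_clamp_homo => //;
    exact: ltW.
  have [|s sP] := @step_approximation T a b (fun t => p - x t) G e a0 ab bT e0 Gc Ginc.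
    move=> s t as_ st tb; have s0 := le_trans a0 as_; have tT := le_trans tb bT.
    have sT := le_trans st tT; have t0 := le_trans s0 st.
    have -> : p - x t - (p - x s) = (u s - u t) - (y s - y t).
      by rewrite subBB /x subACB.
    rewrite /G !clamp_id//.
    have := ler_normB (u s - u t) (y s - y t).
    rewrite (distrC (u s)) (distrC (y s)).
    have := var_dominates T0 uBV s0 st tT; have := var_dominates T0 yBV s0 st tT.
    lra.
  by exists s => t _; exact: sP.
have mset (j : 'I_1) : measurable (`]a, b]%classic : set R) by exact: measurable_itv.
pose s0 : step_map D := StepMap (fun=> p - x c) mset (fun=> abD).
have stepE : step_integral dot mu s0 = dot (p - x c) (y b - y a).
  rewrite /step_integral big_ord1/=; congr (dot _ _).
  exact: (differential_measure_itv_oc mu_y).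
(* Replacing [x] by [x c] turns the integrand into the one-step map [s0]. *)
have [d0 M0] : 0 <= d /\ 0 <= M.
  by split; [apply: le_trans (xd a _ _)|apply: le_trans (pM a _ _)].
have int_ind k : 0 <= k -> (\int[m]_(t in D) (k%:E * (\1_(`]a, b]%classic : set R) t)%:E) =
    (k * (var y b - var y a))%:E)%E.
  move=> k0; rewrite ge0_integralZl//; last exact/measurable_EFinP.
  by rewrite integral_indic// setIidl// [X in (_ * X)%E]mab.
have err : (\int[m]_(t in D) `|W t - step_fun s0 t|%:E <=
    (d * (var y b - var y a))%:E)%E.
  apply: (@le_trans _ _ (\int[m]_(t in D) (d%:E * (\1_(`]a, b]%classic : set R) t)%:E))%E).
    apply: ge0_le_integral => //.
    - exact: (measurable_sub_step mD W_meas s0).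
    - by apply/measurable_EFinP; apply: measurable_funM.
    move=> t Dt; rewrite -EFinM lee_fin indE /W /step_fun big_ord1/= indE.
    case: ifPn => [/andP[at_ tb]|tab]/=; last first.
      by rewrite scale0r subrr normr0 mulr0.
    rewrite scale1r mulr1 subBB distrC.
    by apply: xd => //; exact: ltW.
  by rewrite int_ind.
have sq : (\int[m]_(t in D) (`|W t| ^+ 2)%:E <= (M ^+ 2 * (var y b - var y a))%:E)%E.
  apply: (@le_trans _ _ (\int[m]_(t in D) ((M ^+ 2)%:E * (\1_(`]a, b]%classic : set R) t)%:E))%E).
    apply: ge0_le_integral => //.
    - apply/measurable_EFinP; apply: measurable_funX.
      by have := W_meas 0; under eq_fun do rewrite subr0.
    - by apply/measurable_EFinP; apply: measurable_funM.
    move=> t Dt; rewrite -EFinM lee_fin indE /W.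
    case: ifPn => [/andP[at_ tb]|tab]/=; last by rewrite normr0 mulr0 expr0n.
    by rewrite mulr1 ler_sqr ?nnegrE//; apply: pM => //; exact: ltW.
  by rewrite int_ind ?sqr_ge0.
have := dot_integral_sub_step_le dot_norm mD mu_vm mu_le mDfin vm_m W_meas W_approx s0.
move=> /le_trans/(_ err); rewrite lee_fin stepE => near_s0.
rewrite vm_m => VI.
have dotW_le : dot_integral dot D mu W <=
    (2 * r)^-1 * (M ^+ 2 * (var y b - var y a)).
  rewrite -lee_fin EFinM; apply: le_trans VI _; apply: lee_wpmul2l.
    by rewrite lee_fin invr_ge0 mulr_ge0 ?ler0n ?(ltW r0).
  by under eq_integral do rewrite wEt.
move: near_s0; rewrite ler_distl => /andP[near_s0 _].
by move: near_s0 dotW_le; rewrite mulrDl; lra.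
Qed.

End local_inequality.

(** * Reflection: the variation of [u - 2 y] is the variation of [u] *)

Section play.
Context {R : realType} {H : normedModType R} (dot : {dot H for idfun}).
Hypothesis dot_norm : forall x : H, dot x x = `|x| ^+ 2.
Variables (T r : R) (Z : set H).
Hypotheses (T_gt0 : 0 < T) (r_gt0 : 0 < r).
Implicit Types (u y : R -> H) (a b s t : R).

Let T_ge0 : 0 <= T := ltW T_gt0.

(** The summand [t] makes the gauge strictly increasing. *)
Definition gauge u y t := var u (clamp T t) + var y (clamp T t) + t.

Lemma gauge_continuous u y : CBV T u -> CBV T y -> continuous (gauge u y).
Proof.
move=> [uc uBV] [yc yBV] t; apply: cvgD; last exact: cvg_id.
by apply: cvgD; apply: var_clamp_continuous.
Qed.

Lemma gauge_incr u y : BV T u -> BV T y -> forall s t, s < t ->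
  gauge u y s < gauge u y t.
Proof.
move=> uBV yBV s t st; apply: ler_ltD => //.
by apply: lerD; apply: var_clamp_homo => //; exact: ltW.
Qed.

Lemma gauge_id u y t : 0 <= t -> t <= T -> gauge u y t = var u t + var y t + t.
Proof. by move=> t0 tT; rewrite /gauge clamp_id. Qed.

Section one_play.
Variables (u : R -> H) (z0 : H) (y : R -> H).
Hypotheses (u_CBV : CBV T u) (y_play : is_play dot T r Z u z0 y).

Let x t := u t - y t.

Let y_CBV : CBV T y. Proof. by case: y_play. Qed.
Let uBV : BV T u. Proof. by case: u_CBV. Qed.
Let yBV : BV T y. Proof. by case: y_CBV. Qed.

Let mu := gauge u y.

Let dominates_gauge (f : R -> H) : dominates 0 T f (fun t => var u t + var y t) ->
  forall s t, 0 <= s -> s <= T -> 0 <= t -> t <= T ->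
  `|f t - f s| <= `|mu t - mu s|.
Proof.
move=> fG; have half s t : 0 <= s -> s <= t -> t <= T ->
    `|f t - f s| <= `|mu t - mu s|.
  move=> s0 st tT; have sT := le_trans st tT; have t0 := le_trans s0 st.
  apply: le_trans (fG _ _ s0 st tT) _; apply: le_trans (ler_norm _).
  by rewrite /mu !gauge_id//; lra.
move=> s t s0 sT t0 tT; have [st|ts] := leP s t; first exact: half.
by rewrite distrC [leRHS]distrC; apply: half => //; exact: ltW.
Qed.

Let x_dominated : dominates 0 T x (fun t => var u t + var y t).
Proof.
move=> s t s0 st tT; rewrite /x subACB.
apply: le_trans (ler_normB _ _) _; rewrite opprD addrACA.
by apply: lerD; [exact: (var_dominates T_gt0 uBV)|exact: (var_dominates T_gt0 yBV)].
Qed.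

Let y_dominated : dominates 0 T y (fun t => var u t + var y t).
Proof.
move=> s t s0 st tT; have := var_dominates T_gt0 yBV s0 st tT.
by have := var_homo T_gt0 uBV s0 st tT; lra.
Qed.

(** In the gauge as a parameter both [x] and [y] are Lipschitz, and the
    localized inequality becomes an inequality of second order in the length of
    the interval. *)
Lemma play_small_scale a b : 0 <= a -> a < b -> b <= T ->
  exists tau, [/\ tau 0 = a, tau 1 = b,
    forall s t, 0 <= s -> s <= t -> t <= 1 ->
      [/\ 0 <= tau s, tau s <= tau t & tau t <= T] &
    forall e : R, 0 < e -> exists N, (0 < N)%N /\
      \sum_(i < N) N%:R * `|dot (grid (x \o tau) N i.+1 - grid (x \o tau) N i)
                                (grid (y \o tau) N i.+1 - grid (y \o tau) N i)| <= e].
Proof.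
move=> a0 ab bT.
have muinc := gauge_incr uBV yBV.
have [tau [tau0 tau1 mutau tauP]] :=
  equal_division (ltW ab) (gauge_continuous u_CBV y_CBV) muinc.
have tauT s t : 0 <= s -> s <= t -> t <= 1 ->
      [/\ 0 <= tau s, tau s <= tau t & tau t <= T].
  move=> s0 st t1; have [as_ ? tb] := tauP _ _ s0 st t1.
  by split => //; [exact: le_trans as_|exact: le_trans tb bT].
exists tau; split => //.
pose L := mu b - mu a.
have L0 : 0 < L by rewrite subr_gt0; exact: muinc.
have L_ge0 : 0 <= L by exact: ltW.
have muD s t : 0 <= s -> s <= 1 -> 0 <= t -> t <= 1 ->
    mu (tau t) - mu (tau s) = L * (t - s).
  by move=> *; rewrite /mu !mutau// -/mu -/L; ring.
have lip (f : R -> H) : dominates 0 T f (fun t => var u t + var y t) ->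
    forall s t, 0 <= s -> s <= t -> t <= 1 ->
    `|(f \o tau) t - (f \o tau) s| <= L * (t - s).
  move=> fG s t s0 st t1; have [ts0 tst ttT] := tauT _ _ s0 st t1.
  apply: le_trans (dominates_gauge fG ts0 _ _ ttT) _.
  - exact: le_trans ttT.
  - exact: le_trans tst.
  - have s1 := le_trans st t1; have t0 := le_trans s0 st.
    by rewrite muD// ger0_norm// (mulr_ge0 L_ge0)// subr_ge0.
apply: (@small_scale_orthogonality _ _ dot dot_norm _ _ (L ^+ 3 / (2 * r)) (L ^+ 2) L) => //.
- by apply: divr_ge0; [exact: exprn_ge0|rewrite mulr_ge0 ?ler0n ?(ltW r_gt0)].
- exact: sqr_ge0.
- exact: lip x_dominated.
- exact: lip y_dominated.
move=> a' b' p D a'0 a'b' b'1 p0 p1 pD /=.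
have a'1 := le_trans a'b' b'1; have b'0 := le_trans a'0 a'b'.
have [ta0 tab tbT] := tauT _ _ a'0 a'b' b'1.
have [tp0 _ tpT] := tauT _ _ p0 (lexx p) p1.
have tb0 := le_trans ta0 tab; have taT := le_trans tab tbT.
have between t : tau a' <= t -> t <= tau b' ->
    mu (tau a') <= mu t /\ mu t <= mu (tau b').
  move=> at_ tb; have mule s1 s2 : s1 <= s2 -> mu s1 <= mu s2.
    by rewrite le_eqVlt => /orP[/eqP->//|/muinc/ltW].
  by split; exact: mule.
have D0 : 0 <= D by apply: le_trans (pD a' _ _).
have Zx : Z (x (tau p)).
  by case: y_play => _ Zx _ _; apply: Zx; rewrite in_itv/= tp0.
have := @play_local R H dot dot_norm T r Z u z0 y T_gt0 r_gt0 u_CBV y_play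
  (x (tau p)) (tau a') (tau b') (tau a') (L * D) (L * (b' - a')) Zx ta0 tab tbT
  (lexx _) tab.
move=> /(_ _ _)/wrap[t at_ tb|t at_ tb|VI].
- have t0 := le_trans ta0 at_; have tT := le_trans tb tbT.
  apply: le_trans (dominates_gauge x_dominated t0 tT tp0 tpT) _.
  have [mat mtb] := between t at_ tb.
  pose s := a' + (mu t - mu (tau a')) / L.
  have sE : mu t - mu (tau a') = L * (s - a').
    by rewrite /s (addrC a') addrK mulrCA divff ?mulr1// gt_eqF.
  have as_ : a' <= s by rewrite -subr_ge0 -(pmulr_rge0 _ L0) -sE subr_ge0.
  have sb : s <= b'.
    rewrite -subr_ge0 -(pmulr_rge0 _ L0).
    have := muD _ _ a'0 a'1 b'0 b'1; lra.
  have -> : mu (tau p) - mu t = L * (p - s).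
    by have := muD _ _ a'0 a'1 p0 p1; lra.
  by rewrite normrM gtr0_norm// ler_pM2l// pD.
- have t0 := le_trans ta0 at_; have tT := le_trans tb tbT.
  apply: le_trans (dominates_gauge x_dominated ta0 taT t0 tT) _.
  have [mat mtb] := between t at_ tb.
  rewrite ger0_norm ?subr_ge0// -muD//.
  by rewrite lerD2r.
apply: le_trans VI _.
have -> : (L ^+ 3 / (2 * r) * D ^+ 2 + L ^+ 2 * (b' - a')) * (b' - a') =
    ((L * D) ^+ 2 / (2 * r) + L * (b' - a')) * (L * (b' - a')).
  by field; exact: lt0r_neq0.
apply: ler_wpM2l.
  apply: addr_ge0; last by rewrite (mulr_ge0 L_ge0)// subr_ge0.
  by apply: divr_ge0; [exact: sqr_ge0|rewrite mulr_ge0 ?ler0n ?(ltW r_gt0)].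
rewrite -muD// /mu !gauge_id//.
by have := var_homo T_gt0 uBV ta0 tab tbT; lra.
Qed.

Definition reflected t := u t - 2 *: y t.

Let reflectedE t : reflected t = x t - y t.
Proof. by rewrite /reflected scaler_nat mulr2n opprD addrA. Qed.

Lemma reflected_dominated : dominates 0 T reflected (var u).
Proof.
move=> a b a0; rewrite le_eqVlt => /orP[/eqP->|ab] bT.
  by rewrite !subrr normr0.
have [tau [tau0 tau1 tauT orth]] := play_small_scale a0 ab bT.
have := @dominates_sub_of_add _ _ dot dot_norm _ _ (var u \o tau) orth.
rewrite /= tau0 tau1 !reflectedE; apply.
move=> s t s0 st t1 /=; have [ts0 tst ttT] := tauT _ _ s0 st t1.
rewrite /= /x !subrK; exact: (var_dominates T_gt0 uBV).
Qed.

Lemma reflected_BV : BV T reflected.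
Proof. exact: BV_dominated reflected_dominated. Qed.

(** Orthogonality is not affected by a change of sign of [y], which exchanges [u]
    and the reflected input. *)
Lemma dominated_by_reflected : dominates 0 T u (var reflected).
Proof.
move=> a b a0; rewrite le_eqVlt => /orP[/eqP->|ab] bT.
  by rewrite !subrr normr0.
have [tau [tau0 tau1 tauT orth]] := play_small_scale a0 ab bT.
have := @dominates_sub_of_add _ _ dot dot_norm (x \o tau) (fun s => - y (tau s))
  (var reflected \o tau).
rewrite /= tau0 tau1 !opprK /x !subrK; apply.
  move=> e /orth[N [N0 Ne]]; exists N; split => //; apply: le_trans Ne.
  apply: ler_sum => i _; apply: ler_wpM2l => //.
  by rewrite /grid/= -opprD dotNr normrN.
move=> s t s0 st t1 /=; have [ts0 tst ttT] := tauT _ _ s0 st t1.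
by have := var_dominates T_gt0 reflected_BV ts0 tst ttT; rewrite !reflectedE.
Qed.

Lemma var_reflected_ge : var u T <= var reflected T.
Proof.
have := var_least T_gt0 uBV (lexx 0) T_ge0 (lexx T) dominated_by_reflected.
by rewrite (var0 T_gt0 uBV) (var0 T_gt0 reflected_BV) !subr0.
Qed.

Lemma play_dominated : dominates 0 T y (var u).
Proof.
move=> s t s0 st tT.
have := reflected_dominated s0 st tT; have := var_dominates T_gt0 uBV s0 st tT.
have : `|2 *: (y t - y s)| <= `|u t - u s| + `|reflected t - reflected s|.
  apply: le_trans (ler_normB _ _).
  by rewrite /reflected (subACB (u t) _ (u s)) subKr scalerBr.
by rewrite normrZ gtr0_norm//; lra.
Qed.

Lemma var_play_le : var y T <= var u T.
Proof.
have := var_least T_gt0 yBV (lexx 0) T_ge0 (lexx T) play_dominated.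
by rewrite (var0 T_gt0 uBV) (var0 T_gt0 yBV) !subr0.
Qed.

End one_play.
End play.

(** * Uniform stability *)

Lemma discrete_gronwall {R : realType} (g : nat -> R) (al be h : R) N :
  0 <= al -> 0 <= be -> 0 <= h ->
  (forall i, (i < N)%N -> g i.+1 <= g i + (al * g i + be) * h) ->
  0 <= g 0%N ->
  g N <= (g 0%N + be * (h * N%:R)) * expR (al * (h * N%:R)).
Proof.
move=> al0 be0 h0 step g0.
have ah : 0 <= al * h by rewrite mulr_ge0.
have gle n : (n <= N)%N ->
    g n <= (g 0%N + be * (h * n%:R)) * (1 + al * h) ^+ n.
  elim: n => [_|n IH nN]; first by rewrite expr0 !mulr0 addr0 mulr1.
  apply: le_trans (step n nN) _.
  have -> : g n + (al * g n + be) * h = (1 + al * h) * g n + be * h by ring.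
  apply: (@le_trans _ _ ((1 + al * h) *
     ((g 0%N + be * (h * n%:R)) * (1 + al * h) ^+ n) + be * h)).
    rewrite lerD2r; apply: ler_wpM2l; first by rewrite addr_ge0.
    exact/IH/ltnW.
  rewrite -natr1 exprS.
  have p1 : 1 <= (1 + al * h) * (1 + al * h) ^+ n.
    by rewrite -exprS exprn_ege1// lerDl.
  have : be * h <= be * h * ((1 + al * h) * (1 + al * h) ^+ n).
    by rewrite ler_peMr// mulr_ge0.
  by lra.
apply: le_trans (gle N (leqnn N)) _; apply: ler_wpM2l.
  by rewrite addr_ge0// ?mulr_ge0.
have -> : al * (h * N%:R) = N%:R * (al * h) by ring.
rewrite expRM_natl; apply: lerXn2r.
- by rewrite nnegrE addr_ge0.
- by rewrite nnegrE expR_ge0.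
- exact: expR_ge1Dx.
Qed.

Section stability.
Context {R : realType} {H : normedModType R} (dot : {dot H for idfun}).
Hypothesis dot_norm : forall x : H, dot x x = `|x| ^+ 2.
Variables (T r : R) (Z : set H).
Hypotheses (T_gt0 : 0 < T) (r_gt0 : 0 < r).

Let T_ge0 : 0 <= T := ltW T_gt0.

Variables (u1 u2 y1 y2 : R -> H) (z1 z2 : H).
Hypotheses (u1_CBV : CBV T u1) (u2_CBV : CBV T u2).
Hypothesis y1_play : is_play dot T r Z u1 z1 y1.
Hypothesis y2_play : is_play dot T r Z u2 z2 y2.

Let y1_CBV : CBV T y1. Proof. by case: y1_play. Qed.
Let y2_CBV : CBV T y2. Proof. by case: y2_play. Qed.

Let mu t := gauge T u1 y1 t + gauge T u2 y2 t.

Let mu_cont : continuous mu.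
Proof. by move=> t; apply: cvgD; apply: gauge_continuous. Qed.

Let mu_incr s t : s < t -> mu s < mu t.
Proof.
case: u1_CBV u2_CBV y1_CBV y2_CBV => [_ ?] [_ ?] [_ ?] [_ ?] st.
by apply: ltrD; apply: gauge_incr.
Qed.

Let increments s t : 0 <= s -> s <= t -> t <= T ->
  [/\ `|(u1 t - y1 t) - (u1 s - y1 s)| <= mu t - mu s,
      `|(u2 t - y2 t) - (u2 s - y2 s)| <= mu t - mu s,
      (var y1 t - var y1 s) + (var y2 t - var y2 s) <= mu t - mu s,
      0 <= var y1 t - var y1 s & 0 <= var y2 t - var y2 s].
Proof.
case: u1_CBV u2_CBV y1_CBV y2_CBV => [_ u1B] [_ u2B] [_ y1B] [_ y2B] s0 st tT.
have sT := le_trans st tT; have t0 := le_trans s0 st.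
have du1 := var_dominates T_gt0 u1B s0 st tT.
have du2 := var_dominates T_gt0 u2B s0 st tT.
have dy1 := var_dominates T_gt0 y1B s0 st tT.
have dy2 := var_dominates T_gt0 y2B s0 st tT.
have := ler_normB (u1 t - u1 s) (y1 t - y1 s).
have := ler_normB (u2 t - u2 s) (y2 t - y2 s).
have := normr_ge0 (u1 t - u1 s); have := normr_ge0 (u2 t - u2 s).
have := normr_ge0 (y1 t - y1 s); have := normr_ge0 (y2 t - y2 s).
rewrite /mu !gauge_id// -!(subACB _ (y1 _)) -!(subACB _ (y2 _)).
by move=> ? ? ? ? ? ?; split; lra.
Qed.

(** One step of the explicit recursion: the two localized inequalities, each
    tested with the value of the other solution, are added. *)
Let step a b h sg : 0 <= a -> a <= b -> b <= T -> mu b - mu a = h -> h <= sg ->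
  `|u1 a - u2 a| <= sg ->
  `|y1 b - y2 b| ^+ 2 <= `|y1 a - y2 a| ^+ 2 +
    (4 / (2 * r) * `|y1 a - y2 a| ^+ 2 + (5 * sg + 16 / (2 * r) * sg ^+ 2)) * h.
Proof.
move=> a0 ab bT muh hsg usg; have aT := le_trans ab bT.
have Zx1 : Z (u1 a - y1 a).
  by case: y1_play => _ Zx _ _; apply: Zx; rewrite in_itv/= a0.
have Zx2 : Z (u2 a - y2 a).
  by case: y2_play => _ Zx _ _; apply: Zx; rewrite in_itv/= a0.
pose e := (u1 a - y1 a) - (u2 a - y2 a).
pose d t := y1 t - y2 t.
have [_ _ nu_h nu1 nu2] := increments a0 ab bT; rewrite muh in nu_h.
have h0 : 0 <= h by lra.
have near_a t : a <= t -> t <= b -> mu t - mu a <= h.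
  move=> _; rewrite -muh lerD2r le_eqVlt => /orP[/eqP->//|/mu_incr/ltW//].
have le1 := @play_local R H dot dot_norm T r Z u1 z1 y1 T_gt0 r_gt0 u1_CBV y1_play
  (u2 a - y2 a) a b a (`|e| + h) h Zx2 a0 ab bT (lexx a) ab.
have le2 := @play_local R H dot dot_norm T r Z u2 z2 y2 T_gt0 r_gt0 u2_CBV y2_play
  (u1 a - y1 a) a b a (`|e| + h) h Zx1 a0 ab bT (lexx a) ab.
have {}le1 : - dot e (y1 b - y1 a) <=
    ((`|e| + h) ^+ 2 / (2 * r) + h) * (var y1 b - var y1 a).
  rewrite -dotNl opprB; apply: le1 => t at_ tb;
    have [ix _ _ _ _] := increments a0 at_ (le_trans tb bT).
    apply: le_trans (ler_distD (u1 a - y1 a) _ _) _; rewrite -distrC.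
    apply: lerD => //; rewrite distrC; apply: le_trans ix _; exact: near_a.
  by apply: le_trans ix _; exact: near_a.
have {}le2 : dot e (y2 b - y2 a) <=
    ((`|e| + h) ^+ 2 / (2 * r) + h) * (var y2 b - var y2 a).
  apply: le2 => t at_ tb;
    have [_ ix _ _ _] := increments a0 at_ (le_trans tb bT).
    apply: le_trans (ler_distD (u2 a - y2 a) _ _) _.
    apply: lerD => //; rewrite distrC; apply: le_trans ix _; exact: near_a.
  by apply: le_trans ix _; exact: near_a.
have dE : d b - d a = (y1 b - y1 a) - (y2 b - y2 a) by rewrite /d subACB.
have eE : e = (u1 a - u2 a) - d a by rewrite /e subACB.
have dh : `|d b - d a| <= h.
  case: y1_CBV y2_CBV => [_ y1B] [_ y2B].
  have := var_dominates T_gt0 y1B a0 ab bT.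
  have := var_dominates T_gt0 y2B a0 ab bT.
  by have := ler_normB (y1 b - y1 a) (y2 b - y2 a); rewrite dE; lra.
pose C := (2 * r)^-1.
have C0 : 0 <= C by rewrite invr_ge0 mulr_ge0 ?ler0n ?(ltW r_gt0).
pose Q := (`|e| + h) ^+ 2 * C + h.
have Q0 : 0 <= Q by rewrite addr_ge0// mulr_ge0// sqr_ge0.
have sum_le : - dot e (d b - d a) <= Q * h.
  have : - dot e (d b - d a) <= Q * ((var y1 b - var y1 a) + (var y2 b - var y2 a)).
    by rewrite dE dotBr mulrDr; move: le1 le2; rewrite -/C -/Q; lra.
  by move=> /le_trans; apply; apply: ler_wpM2l.
have du : dot (u1 a - u2 a) (d b - d a) <= sg * h.
  by apply: le_trans (dot_le_norm dot_norm _ _) _; apply: ler_pM.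
have dd : dot (d a) (d b - d a) <= sg * h + Q * h.
  by move: sum_le du; rewrite eE dotBl; lra.
have eh : (`|e| + h) ^+ 2 <= 2 * `|d a| ^+ 2 + 8 * sg ^+ 2.
  have sg0 : 0 <= sg by exact: le_trans hsg.
  have : `|e| + h <= `|d a| + 2 * sg.
    by rewrite eE; have := ler_normB (u1 a - u2 a) (d a); lra.
  have e0 : 0 <= `|e| + h by rewrite addr_ge0.
  have : 0 <= `|d a| by [].
  move: (`|e| + h) `|d a| e0 => X Y X0 Y0 XY.
  have : X ^+ 2 <= (Y + 2 * sg) ^+ 2 by rewrite ler_sqr ?nnegrE ?addr_ge0 ?mulr_ge0.
  by have := sqr_ge0 (Y - 2 * sg); lra.
have Qle : Q <= 2 * C * `|d a| ^+ 2 + 8 * C * sg ^+ 2 + sg.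
  by rewrite /Q; have := ler_wpM2r C0 eh; lra.
have Qh := ler_wpM2r h0 Qle.
have hh : `|d b - d a| ^+ 2 <= sg * h.
  by rewrite expr2; apply: ler_pM => //; exact: le_trans hsg.
have -> : y1 b - y2 b = d a + (d b - d a) by rewrite subrKC.
rewrite (normD_sqr dot_norm) -/(d a).
have -> : 4 / (2 * r) = 4 * C by [].
have -> : 16 / (2 * r) = 16 * C by [].
by move: Qh; lra.
Qed.

(** The steps are equal in the gauge and at most [sg], so that the error made by
    freezing the solutions on a step is of the order of the error of the input. *)
Lemma play_stability sg Lam : 0 < sg ->
  2 * (var u1 T + var u2 T + T) <= Lam ->
  (forall t, 0 <= t -> t <= T -> `|u1 t - u2 t| <= sg) ->
  forall t, 0 <= t -> t <= T ->
  `|y1 t - y2 t| ^+ 2 <= (`|y1 0 - y2 0| ^+ 2 +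
     (5 * sg + 16 / (2 * r) * sg ^+ 2) * Lam) * expR (4 / (2 * r) * Lam).
Proof.
move=> sg0 Lam_ge usg t t0 tT.
have C0 : 0 <= (2 * r)^-1 by rewrite invr_ge0 mulr_ge0 ?ler0n ?(ltW r_gt0).
have [tau [tau0 tau1 mutau tauP]] := equal_division t0 mu_cont mu_incr.
pose L := mu t - mu 0.
have L0 : 0 <= L.
  by rewrite subr_ge0; move: t0; rewrite le_eqVlt => /orP[/eqP->//|/mu_incr/ltW].
have LLam : L <= Lam.
  case: (u1_CBV) (u2_CBV) (y1_CBV) (y2_CBV) => [_ u1B] [_ u2B] [_ y1B] [_ y2B].
  apply: le_trans Lam_ge; rewrite /L /mu !gauge_id//.
  rewrite !(var0 T_gt0 u1B, var0 T_gt0 u2B, var0 T_gt0 y1B, var0 T_gt0 y2B).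
  have := var_homo T_gt0 u1B t0 tT (lexx T).
  have := var_homo T_gt0 u2B t0 tT (lexx T).
  have := var_homo T_gt0 y1B t0 tT (lexx T).
  have := var_homo T_gt0 y2B t0 tT (lexx T).
  have := var_play_le dot_norm T_gt0 r_gt0 u1_CBV y1_play.
  by have := var_play_le dot_norm T_gt0 r_gt0 u2_CBV y2_play; lra.
have [N N0 NP] : exists2 N, (0 < N)%N & L / sg <= N%:R.
  exists (Num.truncn (L / sg)).+1 => //; exact/ltW/truncnS_gt.
have NR : 0 < N%:R :> R by rewrite ltr0n.
pose h := L / N%:R.
have h0 : 0 <= h by rewrite divr_ge0.
have hN : h * N%:R = L by rewrite divfK// gt_eqF.
have hsg : h <= sg by rewrite ler_pdivrMr// mulrC -ler_pdivrMr.
pose p i := tau (i%:R / N%:R).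
have be0 : 0 <= 5 * sg + 16 / (2 * r) * sg ^+ 2.
  by rewrite addr_ge0 ?mulr_ge0 ?sqr_ge0// ltW.
have al0 : 0 <= 4 / (2 * r) by rewrite mulr_ge0.
have := @discrete_gronwall R (fun i => `|y1 (p i) - y2 (p i)| ^+ 2)
  (4 / (2 * r)) (5 * sg + 16 / (2 * r) * sg ^+ 2) h N al0 be0 h0.
have p0 : p 0%N = 0 by rewrite /p mul0r.
have pN : p N = t by rewrite /p divff ?gt_eqF.
rewrite /= hN p0 pN.
move=> /(_ _ (sqr_ge0 _))/wrap[i iN|/le_trans]; last first.
  apply; apply: ler_pM => //.
  - by rewrite addr_ge0 ?sqr_ge0 ?mulr_ge0.
  - by rewrite lerD2l ler_wpM2l.
  - by rewrite ler_expR ler_wpM2l.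
have i0 : 0 <= i%:R / N%:R :> R by rewrite divr_ge0.
have ii : i%:R / N%:R <= i.+1%:R / N%:R :> R.
  by rewrite ler_pM2r ?invr_gt0// ler_nat.
have i1 : i.+1%:R / N%:R <= 1 :> R by rewrite ler_pdivrMr// mul1r ler_nat.
have [pi0 pii pit] := tauP _ _ i0 ii i1.
apply: step => //.
- exact: le_trans pit tT.
- rewrite /p !mutau ?(le_trans i0)// ?(le_trans ii)//.
  by rewrite /h /L -natr1; field; exact: lt0r_neq0.
- by apply: usg => //; exact: le_trans pii (le_trans pit tT).
Qed.

End stability.

(** * From uniform convergence to convergence in variation *)

Section strong_convergence.
Context {R : realType} {H : normedModType R} (dot : {dot H for idfun}).
Hypothesis dot_norm : forall x : H, dot x x = `|x| ^+ 2.
Variable T : R.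
Hypothesis T_gt0 : 0 < T.
Let T_ge0 : 0 <= T := ltW T_gt0.

Lemma var_le_dominated (f : R -> H) G : dominates 0 T f G ->
  var f T <= G T - G 0.
Proof.
move=> fG; have fBV := BV_dominated T_ge0 fG.
have := var_least T_gt0 fBV (lexx 0) T_ge0 (lexx T) fG.
by rewrite (var0 T_gt0 fBV) subr0.
Qed.

Lemma BV_sub (f g : R -> H) : BV T f -> BV T g -> BV T (f \- g).
Proof.
move=> fBV gBV; apply: (@BV_dominated _ _ T _ (fun t => var f t + var g t) T_ge0).
move=> a b a0 ab bT; rewrite /= subACB; apply: le_trans (ler_normB _ _) _.
rewrite opprD addrACA; apply: lerD; first exact: (var_dominates T_gt0 fBV).
exact: (var_dominates T_gt0 gBV).
Qed.

Lemma var_sub_le (f g : R -> H) : BV T f -> BV T g ->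
  forall s t, 0 <= s -> s <= t -> t <= T ->
  `|(var f t - var f s) - (var g t - var g s)| <=
  var (f \- g) t - var (f \- g) s.
Proof.
move=> fBV gBV s t s0 st tT.
have kBV := BV_sub fBV gBV.
have fG : dominates s t f (fun t => var g t + var (f \- g) t).
  move=> a b sa ab bt; have a0 := le_trans s0 sa; have bT := le_trans bt tT.
  have := var_dominates T_gt0 gBV a0 ab bT; have := var_dominates T_gt0 kBV a0 ab bT.
  have -> : f b - f a = ((f \- g) b - (f \- g) a) + (g b - g a).
    by rewrite /= (subACB (f b) (g b)) subrK.
  by have := ler_normD ((f \- g) b - (f \- g) a) (g b - g a); lra.
have gG : dominates s t g (fun t => var f t + var (f \- g) t).
  move=> a b sa ab bt; have a0 := le_trans s0 sa; have bT := le_trans bt tT.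
  have := var_dominates T_gt0 fBV a0 ab bT; have := var_dominates T_gt0 kBV a0 ab bT.
  have -> : g b - g a = (f b - f a) - ((f \- g) b - (f \- g) a).
    by rewrite /= (subACB (f b) (g b)) subKr.
  by have := ler_normB (f b - f a) ((f \- g) b - (f \- g) a); lra.
have := var_least T_gt0 fBV s0 st tT fG; have := var_least T_gt0 gBV s0 st tT gG.
by rewrite ler_norml; lra.
Qed.

(** Let [w] be approximated by a step function [phi] with unit values in the
    direction of its increments. If the variation of a second function is also
    exhausted by its component along [phi], then the two functions are
    close to the integrals of [phi] against [var u] and [var u']. *)
Lemma strong_convergence_estimate (u w : R -> H) (eta : R) : 0 < eta ->
  BV T u -> dominates 0 T w (var u) -> var u T <= var w T ->
  exists m : nat, forall (u' w' : R -> H) (ka de : R),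
    BV T u' -> dominates 0 T w' (var u') -> var (u' \- u) T <= ka ->
    (forall t, 0 <= t -> t <= T -> `|w' t - w t| <= de) ->
    var (w' \- w) T <= eta * (2 * var u T + ka) +
      (ka + 2 * m%:R * de + eta ^+ 2) / (2 * eta) + ka + eta / 2.
Proof.
move=> eta0 uBV wu uw; have wBV := BV_dominated T_ge0 wu.
have [p [m [pc p0 pm pw]]] := partition_near_var T_gt0 wBV (exprn_gt0 2 eta0).
exists m => u' w' ka de u'BV w'u' kale dele.
have w'BV := BV_dominated T_ge0 w'u'.
pose phi j := `|w (p j.+1) - w (p j)|^-1 *: (w (p j.+1) - w (p j)).
have phi1 j : `|phi j| <= 1.
  rewrite /phi; have [->|d0] := eqVneq (w (p j.+1) - w (p j)) 0.
    by rewrite scaler0 normr0.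
  by rewrite normrZ normfV normr_id mulVf ?normr_eq0.
have phiw j : dot (phi j) (w (p j.+1) - w (p j)) = `|w (p j.+1) - w (p j)|.
  rewrite /phi dotZl dot_norm; have [->|d0] := eqVneq (w (p j.+1) - w (p j)) 0.
    by rewrite normr0 expr0n mulr0.
  by rewrite expr2 mulKf ?normr_eq0.
pose ups j t := eta * var u' t + (var u' t - dot (phi j) (w' t)) / (2 * eta) +
  var (u' \- u) t + (eta * var u t + (var u t - dot (phi j) (w t)) / (2 * eta)).
have fdom j : dominates (p j) (p j.+1) (w' \- w) (ups j).
  move=> s t ps st tp; have [pj0 _ _] := pc j; have [_ pT _] := pc j.+1.
  have s0 := le_trans pj0 ps; have tT := le_trans tp pT.
  have e1 := norm_sub_direction_le dot_norm eta0 (w'u' _ _ s0 st tT) (phi1 j).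
  have e2 := norm_sub_direction_le dot_norm eta0 (wu _ _ s0 st tT) (phi1 j).
  have e3 := var_sub_le u'BV uBV s0 st tT.
  have E : (w' \- w) t - (w' \- w) s =
     (w' t - w' s - (var u' t - var u' s) *: phi j) +
     ((var u' t - var u' s) - (var u t - var u s)) *: phi j -
     (w t - w s - (var u t - var u s) *: phi j).
    rewrite /= subACB; move: (w' t - w' s) (w t - w s) => A B.
    move: (var u' t - var u' s) (var u t - var u s) => a b.
    by rewrite scalerBl addrA subrK (subACB A) subrr subr0.
  rewrite E; apply: le_trans (ler_normB _ _) _.
  have := ler_normD (w' t - w' s - (var u' t - var u' s) *: phi j)
    (((var u' t - var u' s) - (var u t - var u s)) *: phi j).
  have e4 : `|((var u' t - var u' s) - (var u t - var u s)) *: phi j| <=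
      var (u' \- u) t - var (u' \- u) s.
    by rewrite normrZ; apply: le_trans e3; rewrite ler_piMr.
  by move: e1 e2 e4; rewrite /ups !dotBr; lra.
have kBV := BV_sub u'BV uBV.
have fBV := BV_sub w'BV wBV.
have telescope (g : R -> R) : g 0 = 0 ->
    \sum_(j < m) g (p j.+1) - \sum_(j < m) g (p j) = g T.
  move=> g0; rewrite -sumrB -(big_mkord xpredT (fun j => g (p j.+1) - g (p j))).
  by rewrite telescope_sumr// pm p0 g0 subr0.
have V0 (g : R -> H) (gBV : BV T g) : var g 0 = 0 by exact: (var0 T_gt0 gBV).
have -> : var (w' \- w) T = \sum_(j < m) (var (w' \- w) (p j.+1) - var (w' \- w) (p j)).
  by rewrite sumrB (telescope (var (w' \- w)))// V0.
pose dw j := dot (phi j) (w' (p j.+1) - w' (p j)).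
apply: (@le_trans _ _ (\sum_(j < m) (
    eta * (var u' (p j.+1) - var u' (p j)) +
    ((var u' (p j.+1) - var u' (p j)) - dw j) / (2 * eta) +
    (var (u' \- u) (p j.+1) - var (u' \- u) (p j)) +
    (eta * (var u (p j.+1) - var u (p j)) +
    ((var u (p j.+1) - var u (p j)) - `|w (p j.+1) - w (p j)|) / (2 * eta))))).
  apply: ler_sum => j _; have [pj0 _ pjj] := pc j; have [_ pT _] := pc j.+1.
  apply: le_trans (var_least T_gt0 fBV pj0 pjj pT (fdom j)) _.
  by rewrite /ups /dw -phiw !dotBr; lra.
rewrite !big_split/= -!mulr_sumr -!mulr_suml !sumrB sumrN.
rewrite (telescope (var u') (V0 _ u'BV)) (telescope (var u) (V0 _ uBV)).
rewrite (telescope (var (u' \- u)) (V0 _ kBV)).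
rewrite -/(chain_sum w p m).
have dwle : chain_sum w p m - 2 * m%:R * de <= \sum_(j < m) dw j.
  rewrite /chain_sum lerBlDr.
  have -> : 2 * m%:R * de = \sum_(j < m) (2 * de).
    by rewrite sumr_const card_ord -[RHS]mulr_natr; ring.
  rewrite -big_split/=; apply: ler_sum => j _; rewrite -phiw /dw.
  have [pj0 pjT _] := pc j; have [pjj0 pjjT _] := pc j.+1.
  rewrite -lerBlDl -dotBr; apply: le_trans (dot_le_norm dot_norm _ _) _.
  apply: (@le_trans _ _ `|w (p j.+1) - w (p j) - (w' (p j.+1) - w' (p j))|).
    by rewrite ler_piMl.
  rewrite subACB; apply: le_trans (ler_normB _ _) _.
  have := dele _ pj0 pjT; have := dele _ pjj0 pjjT.
  by rewrite distrC [`|w' (p j) - _|]distrC; lra.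
have u'le : var u' T <= var u T + ka.
  have := var_sub_le u'BV uBV (lexx 0) T_ge0 (lexx T).
  by rewrite !V0// !subr0 ler_norml => /andP[_]; lra.
have i0 : 0 <= (2 * eta)^-1 by rewrite invr_ge0 mulr_ge0// ltW.
have A1 : (var u' T - \sum_(j < m) dw j) / (2 * eta) <=
    (ka + 2 * m%:R * de + eta ^+ 2) / (2 * eta).
  by apply: ler_wpM2r => //; lra.
have A2 : (var u T - chain_sum w p m) / (2 * eta) <= eta / 2.
  rewrite ler_pdivrMr ?mulr_gt0//.
  have -> : eta / 2 * (2 * eta) = eta ^+ 2 by field.
  lra.
have A3 : eta * var u' T <= eta * (var u T + ka) by rewrite ler_pM2l.
lra.
Qed.

End strong_convergence.

Lemma cvge0_le {R : realType} (f : nat -> \bar R) : (forall n, (0 <= f n)%E) ->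
  (forall e : R, 0 < e -> \forall n \near \oo, (f n <= e%:E)%E) ->
  f @ \oo --> 0%E.
Proof.
move=> f0 fe; apply/fine_cvgP; split.
  apply: filterS (fe 1 ltr01) => n fn; rewrite ge0_fin_numE//.
  by apply: le_lt_trans fn _; rewrite ltry.
apply/cvgrPdist_le => e e0; apply: filterS (fe e e0) => n fn.
have fin_n : f n \is a fin_num.
  by rewrite ge0_fin_numE//; apply: le_lt_trans fn _; rewrite ltry.
rewrite /= sub0r normrN ger0_norm ?fine_ge0//.
by rewrite -lee_fin fineK.
Qed.

Lemma variation_on_ge0 {R : realType} {H : normedModType R} (T : R)
    (f : R -> H) : 0 < T -> (0 <= variation_on f `[0%R, T])%E.
Proof.
move=> T0; apply: (@le_trans _ _ (chain_sum f (fun=> 0) 0)%:E).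
  by rewrite lee_fin /chain_sum big_ord0.
by apply: chain_sum_le_variation => // j; rewrite lexx ltW.
Qed.

Lemma sup_norm_ge0 {R : realType} {H : normedModType R} (T : R) (f : R -> H) :
  0 <= T -> (0 <= sup_norm T f)%E.
Proof.
move=> T0; apply: (@le_trans _ _ (`|f 0|)%:E); first by rewrite lee_fin.
by apply: ereal_sup_ubound; exists 0 => //=; rewrite in_itv/= lexx.
Qed.

Lemma BV_norm_bounds {R : realType} {H : normedModType R} (T : R) (f : R -> H)
    (k : R) : 0 < T -> (BV_norm T f <= k%:E)%E ->
  [/\ BV T f, var f T <= k & forall t, 0 <= t -> t <= T -> `|f t| <= k].
Proof.
move=> T0 fk.
have v0 := variation_on_ge0 f T0; have s0 := sup_norm_ge0 f (ltW T0).
have vk : (variation_on f `[0%R, T] <= k%:E)%E.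
  by apply: le_trans fk; rewrite leeDr.
have fBV : BV T f by apply: le_lt_trans vk _; rewrite ltry.
split => //.
  by rewrite -lee_fin; apply: le_trans (var_le_fine T0 fBV) vk.
move=> t t0 tT; rewrite -lee_fin; apply: le_trans fk.
apply: (@le_trans _ _ (sup_norm T f)); last by rewrite leeDl.
by apply: ereal_sup_ubound; exists t => //=; rewrite in_itv/= t0.
Qed.

Lemma BV_norm_le {R : realType} {H : normedModType R} (T : R) (f : R -> H)
    (G : R -> R) (k : R) : 0 <= T -> dominates 0 T f G ->
  (forall t, 0 <= t -> t <= T -> `|f t| <= k) ->
  (BV_norm T f <= (k + (G T - G 0))%:E)%E.
Proof.
move=> T0 fG fk; rewrite EFinD; apply: leeD; last exact: variation_on_le.
apply: ub_ereal_sup => _ [t tT <-]; rewrite lee_fin.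
by move: tT; rewrite /= in_itv/= => /andP[t0 tT]; exact: fk.
Qed.

Theorem theorem3p2 (R : realType) (H : completeNormedModType R)
    (dot : {dot H for idfun})
    (dot_norm : forall x : H, dot x x = `|x| ^+ 2)
    (H_nontrivial : exists x : H, x != 0)
    (T r : R) (T_gt0 : 0 < T) (r_gt0 : 0 < r)
    (Z : set H) (Z_prox : prox_regular r Z)
    (u : R -> H) (u_ : nat -> R -> H) (z0 : H) (z_ : nat -> H)
    (u_CBV : CBV T u) (u_n_CBV : forall n, CBV T (u_ n))
    (z0_Z : Z z0) (z_n_Z : forall n, Z (z_ n))
    (y : R -> H) (y_ : nat -> R -> H)
    (y_play : is_play dot T r Z u z0 y)
    (y_n_play : forall n, is_play dot T r Z (u_ n) (z_ n) (y_ n))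
    (u_cvg : BV_norm T (u \- u_ n) @[n --> \oo] --> 0%E)
    (z_cvg : `|z0 - z_ n| @[n --> \oo] --> (0 : R)) :
  BV_norm T (y \- y_ n) @[n --> \oo] --> 0%E.
Proof.
have T_ge0 := ltW T_gt0; have uBV : BV T u by case: u_CBV.
have unBV n : BV T (u_ n) by case: (u_n_CBV n).
pose V := var u T.
have V_ge0 : 0 <= V.
  by rewrite -(var0 T_gt0 uBV); exact: (var_homo T_gt0 uBV (lexx 0) T_ge0 (lexx T)).
(* The norm controls the variation from 0 and the values separately. *)
have data k : 0 < k -> \forall n \near \oo,
    [/\ var (u_ n \- u) T <= k,
        forall t, 0 <= t -> t <= T -> `|u t - u_ n t| <= k & `|z0 - z_ n| <= k].
  move=> k0; have /fine_cvgP[ufin /cvgrPdist_le/(_ _ k0) ule] := u_cvg.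
  have /cvgrPdist_le/(_ _ k0) zle := z_cvg.
  apply: filterS3 ufin ule zle => n; pose f : R -> H := u \- u_ n.
  rewrite -/f /= => fin_n un_le zn_le.
  have un : (BV_norm T f <= k%:E)%E.
    rewrite -(fineK fin_n) lee_fin.
    by move: un_le; rewrite sub0r normrN; apply: le_trans; exact: ler_norm.
  have [dBV dvar dsup] := BV_norm_bounds T_gt0 un.
  split => //; last by move: zn_le; rewrite sub0r normrN normr_id.
  apply: le_trans dvar.
  have : dominates 0 T (u_ n \- u) (var f).
    move=> s t s0 st tT; have := var_dominates T_gt0 dBV s0 st tT.
    by rewrite /f/= (subACB (u_ n t)) (subACB (u t)) distrC.
  by move=> /(var_le_dominated T_gt0); rewrite (var0 T_gt0 dBV) subr0.
pose C := (2 * r)^-1.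
have C_ge0 : 0 <= C by rewrite invr_ge0 mulr_ge0 ?ler0n ?(ltW r_gt0).
pose Lam := 2 * (2 * V + 1 + T).
have Lam_ge0 : 0 <= Lam by rewrite mulr_ge0 ?addr_ge0 ?mulr_ge0.
have uniform e : 0 < e -> \forall n \near \oo,
    forall t, 0 <= t -> t <= T -> `|y t - y_ n t| <= e.
  move=> e0.
  pose K := expR (4 / (2 * r) * Lam).
  have K0 : 0 < K by exact: expR_gt0.
  (* For [sg <= 1] the bound of [play_stability] is at most [B * sg]: the initial
     error contributes [(2 * sg) ^ 2 <= 4 * sg]. *)
  pose B := (4 + (5 + 16 * C) * Lam) * K.
  have B0 : 0 < B.
    by rewrite mulr_gt0// ltr_pwDl// ?mulr_ge0 ?addr_ge0 ?mulr_ge0.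
  pose sg := Num.min 1 (e ^+ 2 / B).
  have sg0 : 0 < sg by rewrite lt_min ltr01 divr_gt0// exprn_gt0.
  have sg1 : sg <= 1 by rewrite ge_min lexx.
  have sgB : B * sg <= e ^+ 2.
    by rewrite mulrC -ler_pdivlMr// ge_min lexx orbT.
  apply: filterS (data sg sg0) => n [kvar ksup zn] t t0 tT.
  have VLam : 2 * (var u T + var (u_ n) T + T) <= Lam.
    have := var_sub_le T_gt0 (unBV n) uBV (lexx 0) T_ge0 (lexx T).
    rewrite !(var0 T_gt0 (unBV n), var0 T_gt0 uBV) ler_norml => /andP[_].
    have kBV := BV_sub T_gt0 (unBV n) uBV.
    by rewrite (var0 T_gt0 kBV) /Lam -/V; lra.
  have := play_stability dot_norm T_gt0 r_gt0 u_CBV (u_n_CBV n) y_play (y_n_play n)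
    sg0 VLam ksup t0 tT.
  rewrite -/K => stab; rewrite -ler_sqr ?nnegrE ?(ltW e0)//.
  apply: le_trans stab _; apply: le_trans sgB; rewrite /B [leRHS]mulrAC ler_pM2r//.
  have d0 : `|y 0 - y_ n 0| <= 2 * sg.
    have [_ _ y0 _] := y_play; have [_ _ yn0 _] := y_n_play n.
    have -> : y 0 - y_ n 0 = (u 0 - u_ n 0) - (z0 - z_ n).
      by rewrite -y0 -yn0 (subACB (u 0) (y 0)) subKr.
    have := ler_normB (u 0 - u_ n 0) (z0 - z_ n).
    by have := ksup 0 (lexx 0) T_ge0; lra.
  have s2 : sg ^+ 2 <= sg by rewrite expr2 ler_piMr// ltW.
  have d2 : `|y 0 - y_ n 0| ^+ 2 <= 4 * sg.
    apply: (@le_trans _ _ ((2 * sg) ^+ 2)).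
      by rewrite ler_sqr ?nnegrE ?mulr_ge0// ltW.
    by rewrite exprMn; lra.
  have -> : 16 / (2 * r) = 16 * C by [].
  have : (5 * sg + 16 * C * sg ^+ 2) * Lam <= (5 * sg + 16 * C * sg) * Lam.
    by apply: ler_wpM2r => //; rewrite lerD2l ler_wpM2l// mulr_ge0.
  by lra.
apply: cvge0_le => [n|e e0].
  by apply: adde_ge0; [exact: sup_norm_ge0|exact: variation_on_ge0].
pose w := reflected u y; pose w_ n := reflected (u_ n) (y_ n).
(* [eta] is chosen first; it determines the partition size [m], and then [ka] and
   [de] bound the errors of the inputs and of the reflected inputs. *)
pose c := 2 * V + 4.
have c0 : 0 < c by rewrite ltr_wpDl// mulr_ge0.
pose eta := Num.min 1 (e / (4 * c)).
have eta0 : 0 < eta by rewrite lt_min ltr01 divr_gt0// mulr_gt0.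
have eta1 : eta <= 1 by rewrite ge_min lexx.
have etac : eta * c <= e / 4.
  rewrite -ler_pdivlMr// (_ : e / 4 / c = e / (4 * c)).
    by rewrite ge_min lexx orbT.
  by field; rewrite gt_eqF.
have wu := reflected_dominated dot_norm T_gt0 r_gt0 u_CBV y_play.
have uw := var_reflected_ge dot_norm T_gt0 r_gt0 u_CBV y_play.
have [m mP] := strong_convergence_estimate dot_norm T_gt0 eta0 uBV wu uw.
pose ka := Num.min (eta ^+ 2) (e / 4).
have ka0 : 0 < ka by rewrite lt_min exprn_gt0//= divr_gt0.
have ka_eta : ka <= eta ^+ 2 by rewrite ge_min lexx.
have ka_e : ka <= e / 4 by rewrite ge_min lexx orbT.
pose de := eta ^+ 2 / (2 * m.+1%:R).
have de0 : 0 < de by rewrite divr_gt0// ?exprn_gt0// mulr_gt0.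
have de_le : 2 * m%:R * de <= eta ^+ 2.
  rewrite /de mulrCA ler_piMr ?sqr_ge0// ler_pdivrMr ?mulr_gt0// mul1r.
  by rewrite ler_pM2l// ler_nat.
pose de' := Num.min (de / 4) (e / 4).
have de'0 : 0 < de' by rewrite lt_min; apply/andP; split; apply: divr_gt0.
pose k := Num.min ka (de / 2).
have k0 : 0 < k by rewrite lt_min ka0 divr_gt0.
have k_ka : k <= ka by rewrite ge_min lexx.
have k_de : k <= de / 2 by rewrite ge_min lexx orbT.
have de'_de : de' <= de / 4 by rewrite ge_min lexx.
have de'_e : de' <= e / 4 by rewrite ge_min lexx orbT.
apply: filterS2 (data k k0) (uniform de' de'0) => n [kvar ksup _] yn.
have wnun := reflected_dominated dot_norm T_gt0 r_gt0 (u_n_CBV n) (y_n_play n).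
have wnw t : 0 <= t -> t <= T -> `|w_ n t - w t| <= de.
  move=> t0 tT; rewrite /w /w_ /reflected subACB -scalerBr.
  apply: le_trans (ler_normB _ _) _; rewrite normrZ gtr0_norm//.
  by have := ksup t t0 tT; have := yn t t0 tT; rewrite distrC [`|u t - _|]distrC; lra.
have := mP (u_ n) (w_ n) k de (unBV n) wnun kvar wnw.
set X := var _ T => Xle.
have Xe : X <= e / 2 + e / 4.
  have : (k + 2 * m%:R * de + eta ^+ 2) / (2 * eta) <= 3 * eta / 2.
    rewrite ler_pdivrMr ?mulr_gt0//.
    have -> : 3 * eta / 2 * (2 * eta) = 3 * eta ^+ 2 by field.
    lra.
  have : eta * (2 * var u T + k) <= eta * (2 * V + 1).
    rewrite ler_pM2l// lerD2l; apply: le_trans k_ka (le_trans ka_eta _).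
    by rewrite exprn_ile1// ltW.
  by move: etac Xle; rewrite /c; lra.
have wBV : BV T (w_ n \- w).
  by apply: (BV_sub T_gt0); [exact: BV_dominated wnun|exact: BV_dominated wu].
have uBV' := BV_sub T_gt0 (unBV n) uBV.
have ydom : dominates 0 T (y \- y_ n)
    (fun t => (var (u_ n \- u) t + var (w_ n \- w) t) / 2).
  move=> s t s0 st tT.
  have := var_dominates T_gt0 uBV' s0 st tT; have := var_dominates T_gt0 wBV s0 st tT.
  set dU := (u_ n \- u) t - _; set dW := (w_ n \- w) t - _.
  have E : 2 *: ((y \- y_ n) t - (y \- y_ n) s) = dW - dU.
    have F a : (w_ n \- w) a - (u_ n \- u) a = 2 *: (y a - y_ n a).
      rewrite /w /w_ /reflected/= (subACB (u_ n a)) addrAC subrr sub0r.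
      by rewrite opprB scalerBr.
    by rewrite scalerBr /= -!F /dW /dU subACB.
  have : `|2 *: ((y \- y_ n) t - (y \- y_ n) s)| <= `|dW| + `|dU|.
    by rewrite E; exact: ler_normB.
  by rewrite normrZ gtr0_norm//; lra.
apply: le_trans (BV_norm_le T_ge0 ydom yn) _.
rewrite lee_fin (var0 T_gt0 uBV') (var0 T_gt0 wBV) addr0 mul0r subr0.
by rewrite -/X; lra.
Qed.
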